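(* Let $K$ be an infinite field, $n\ge2$, $R=K[x_0,\dots,x_n]$, and let $I\subset R$ be the defining ideal of a complete grid of lines, or of a complete pseudo-grid of lines, of type $(\ell_1,\dots,\ell_n)$ in $\mathbb P^n_K$. Then $I$ has minimal graded free resolution $$0\to F_{n-2}\to F_{n-3}\to\cdots\to F_1\to F_0\to I\to0,$$ $$F_h=\bigoplus_{1\le i_1<\dots<i_{h+2}\le n}R^{\,h+1}(-\ell_{i_1}-\cdots-\ell_{i_{h+2}}),\qquad 0\le h\le n-2,$$ with maps given by the iterated mapping cone procedure described in the context, applied to the forms $f_j=\prod_{i=1}^{\ell_j}L_{j,i}$, $1\le j\le n$, where $(L_{j,i})$ is the ($1$-lifting, respectively pseudo-$1$-lifting) matrix determining $I$; that is, at each step the maps are given by the block matrices $M_{\gamma_i}=\begin{pmatrix}-M_{\delta_{i-1}}&0\\ M_{\alpha_{i-1}}&M_{\varphi_i}\end{pmatrix}$, $i\ge1$.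
   Context: Let $\ell_1,\dots,\ell_n\ge1$, $S=K[x_1,\dots,x_n]$. Complete grid: let $A_j=\{a_{j1},\dots,a_{j\ell_j}\}\subset K$ have $\ell_j$ elements ($1\le j\le n$) and let $X\subset\mathbb P^n_K$ be the set of the $\ell_1\cdots\ell_n$ points with coordinates in $\{1\}\times A_1\times\cdots\times A_n$ (coordinates counted from $0$ to $n$). Let $p_{\infty,k}$ be the point whose only nonzero coordinate is the $k$-th one. The complete grid of lines of type $(\ell_1,\dots,\ell_n)$ with basis $X$ is the union of the lines joining $p$ and $p_{\infty,k}$, for $p\in X$, $1\le k\le n$. Its determining matrix is $L_{j,i}=x_j-a_{ji}x_0$ ($1\le j\le n$, $1\le i\le r$, $r=\max_j\ell_j$, each $A_j$ being completed to $r$ distinct elements). Complete pseudo-grid: let $A=(L_{j,i})_{1\le j\le n,1\le i\le r}$, $r\ge\max_j\ell_j$, be a matrix of linear forms in $R$ such that, for all $1\le i_1,\dots,i_n\le r$, the vector spaces $\langle L_{1,i_1},\dots,L_{n,i_n}\rangle$ are $n$-dimensional and pairwise distinct. For $\tau=x_1^{\alpha_1}\cdots x_n^{\alpha_n}$ with all $\alpha_j\le r$, put $\tilde\tau=\prod_{j=1}^n\prod_{i=1}^{\alpha_j}L_{j,i}\in R$. The pseudo-$1$-lifting via $A$ of a monomial ideal $J\subset S$ with minimal monomial generators $\tau_1,\dots,\tau_s$ is $(\tilde\tau_1,\dots,\tilde\tau_s)\subset R$. The complete pseudo-grid of type $(\ell_1,\dots,\ell_n)$ determined by $A$ is the projective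 scheme defined by the pseudo-$1$-lifting via $A$ of $\Omega=\bigcap_{k=1}^n(x_1^{\ell_1},\dots,\widehat{x_k^{\ell_k}},\dots,x_n^{\ell_n})=(x_j^{\ell_j}x_k^{\ell_k}:1\le j<k\le n)$. (The defining ideal of a complete grid is, likewise, the pseudo-$1$-lifting of $\Omega$ via its determining matrix.) Iterated mapping cone procedure for $(f_if_j:i<j)$, where $\deg f_j=\ell_j$. Start from $(f_{n-1}f_n)$ with resolution $0\to R(-\ell_{n-1}-\ell_n)\to (f_{n-1}f_n)\to 0$. For $k=n-2,\dots,1$ in this order and, for each $k$, for $j=n,n-1,\dots,k+1$ in this order, add $g=f_kf_j$ to $I'=(f_kf_{j+1},\dots,f_kf_n)+(f_af_b: k+1\le a<b\le n)$. One has $(I':g)=(f_{k+1},\dots,\widehat{f_j},\dots,f_n)$, a complete intersection, resolved by its minimal free (Koszul) resolution $\cdots\to E_1\xrightarrow{\delta_1}E_0\xrightarrow{\delta_0}(I':g)\to0$. Let $\cdots\to F'_1\xrightarrow{\varphi_1}F'_0\xrightarrow{\varphi_0}I'\to0$ be the resolution of $I'$ already constructed. Multiplication by $g$ lifts to degree-$0$ maps $\alpha_i:E_i(-\deg g)\to F'_i$ with $\varphi_0\alpha_0=g\,\delta_0$ and $\varphi_i\alpha_i=\alpha_{i-1}\delta_i$ for $i\ge1$. The mapping cone is the resolution of $(g)+I'$ with modules $R(-\deg g)\oplus F'_0$ in position $0$ and $E_{i-1}(-\deg g)\oplus F'_i$ in position $i\ge1$, with $\gamma_0$ given by the generators ($g$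 first), and $\gamma_i(a,b)=(-\delta_{i-1}(a),\alpha_{i-1}(a)+\varphi_i(b))$ for $i\ge1$. $M_\psi$ denotes the matrix of $\psi$ in the canonical bases. *)

(* Defs.v *)
From mathcomp Require Export all_boot all_order all_algebra.
From mathcomp Require Export mpoly.
From mathcomp Require classical_sets cardinality.

Set Implicit Arguments.
Unset Strict Implicit.
Unset Printing Implicit Defensive.

Import GRing.Theory.
Local Open Scope ring_scope.

Definition infinite_field (K : fieldType) : Prop :=
  ~ cardinality.finite_set (@classical_sets.setT K).

(* Ideals are Prop-valued predicates: MathComp's [idealr] is restricted to
   decidable proper ideals. *)
Definition ideal_gen (A : comNzRingType) (G : A -> Prop) (p : A) : Prop :=
  exists s : seq (A * A),
    (forall u, u \in s -> G u.2) /\ p = \sum_(u <- s) u.1 * u.2.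

(* ------------------------------------------------------------------------ *)
(* The coordinates x_0, ..., x_n of P^n are indexed by 'I_n.+1.  The paper's *)
(* x_1, ..., x_n are the variables of index [lift ord0 j], for j : 'I_n.     *)
(* The i-th column (i = 1, ..., r) of a matrix has index i - 1 : 'I_r, so    *)
(* that the condition i <= l reads i < l below.                              *)
(* ------------------------------------------------------------------------ *)

Notation linear_form K n := (dhomog n.+1 K 1).

Definition grid_form (K : fieldType) (n r : nat) (l : 'I_n -> nat)
    (L : 'M[linear_form K n]_(n, r)) (j : 'I_n) : {mpoly K[n.+1]} :=
  \prod_(i < r | (i < l j)%N) mpoly_of_dhomog (L j i).

(* Sets of points of P^n are represented by the predicate of being a vector
   of homogeneous coordinates of one of their points. *)
Definition proj_vanishing_ideal (K : fieldType) (n : nat)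
    (Y : 'rV[K]_(1 + n) -> Prop) : {mpoly K[n.+1]} -> Prop :=
  ideal_gen (fun p => (exists d : nat, p \is d.-homog)
                      /\ forall v, Y v -> p.@[v 0] = 0).

Definition grid_basis (K : fieldType) (n r : nat) (l : 'I_n -> nat)
    (a : 'M[K]_(n, r)) (p : 'rV[K]_(1 + n)) : Prop :=
  exists i : 'I_n -> 'I_r, (forall j, (i j < l j)%N)
    /\ p = row_mx 1%:M (\row_j a j (i j)).

Definition point_at_infinity (K : fieldType) (n : nat) (k : 'I_n) :
    'rV[K]_(1 + n) :=
  row_mx 0 (delta_mx 0 k).

Definition proj_line (K : fieldType) (n : nat) (p q v : 'rV[K]_(1 + n)) :
    Prop :=
  exists s t : K, (s, t) != (0, 0) /\ v = s *: p + t *: q.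

Definition complete_grid (K : fieldType) (n r : nat) (l : 'I_n -> nat)
    (a : 'M[K]_(n, r)) (v : 'rV[K]_(1 + n)) : Prop :=
  exists p k, grid_basis l a p /\ proj_line p (point_at_infinity K k) v.

(* Row j of [a] lists the l j elements of A_j first, followed by those that
   complete it to r distinct elements. *)
Definition complete_grid_ideal (K : fieldType) (n r : nat) (l : 'I_n -> nat)
    (L : 'M[linear_form K n]_(n, r)) (I : {mpoly K[n.+1]} -> Prop) : Prop :=
  exists a : 'M[K]_(n, r),
    [/\ r = (\max_(j < n) l j)%N,
        forall j, injective (a j),
        forall j i, mpoly_of_dhomog (L j i)
                    = 'X_(lift ord0 j) - a j i *: 'X_ord0
      & forall p, I p <-> proj_vanishing_ideal (complete_grid l a) p].

Definition pseudo_lifting_matrix (K : fieldType) (n r : nat)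
    (L : 'M[linear_form K n]_(n, r)) : Prop :=
  let V (i : {ffun 'I_n -> 'I_r}) : {vspace linear_form K n} :=
    <<[seq L j (i j) | j <- enum 'I_n]>>%VS in
  (forall i, \dim (V i) = n) /\ injective V.

(* Meaningful when all the exponents of [m] are at most r. *)
Definition lift_monomial (K : fieldType) (n r : nat)
    (L : 'M[linear_form K n]_(n, r)) (m : 'X_{1..n}) : {mpoly K[n.+1]} :=
  \prod_(j < n) \prod_(i < r | (i < m j)%N) mpoly_of_dhomog (L j i).

Definition minimal_monomial (K : fieldType) (n : nat)
    (J : {mpoly K[n]} -> Prop) (m : 'X_{1..n}) : Prop :=
  J 'X_[m] /\ forall m' : 'X_{1..n}, J 'X_[m'] -> (m' <= m)%MM -> m' = m.

Definition pseudo_lifting (K : fieldType) (n r : nat)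
    (L : 'M[linear_form K n]_(n, r)) (J : {mpoly K[n]} -> Prop) :
    {mpoly K[n.+1]} -> Prop :=
  ideal_gen (fun p => exists2 m, minimal_monomial J m & p = lift_monomial L m).

Definition Omega (K : fieldType) (n : nat) (l : 'I_n -> nat)
    (p : {mpoly K[n]}) : Prop :=
  forall k : 'I_n,
    ideal_gen (fun q : {mpoly K[n]} => exists2 j, j != k & q = 'X_j ^+ l j) p.

Definition complete_pseudo_grid_ideal (K : fieldType) (n r : nat)
    (l : 'I_n -> nat) (L : 'M[linear_form K n]_(n, r))
    (I : {mpoly K[n.+1]} -> Prop) : Prop :=
  [/\ (\max_(j < n) l j <= r)%N,
      pseudo_lifting_matrix L
    & forall p, I p <-> pseudo_lifting L (@Omega K n l) p].

(* ------------------------------------------------------------------------ *)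
(* Complexes of finitely generated graded free modules                       *)
(*   ... -> F_1 -> F_0 -> R,   R = K[x_0, ..., x_{N-1}].                     *)
(* F_i has a basis of rank [cx_rank i], the s-th element having degree       *)
(* [cx_deg i s]; thus F_i is the sum of the R(- cx_deg i s).  Elements of    *)
(* F_i are column vectors, and matrices act on the left.  [cx_aug] is the    *)
(* matrix of F_0 -> R.                                                       *)
(* ------------------------------------------------------------------------ *)

Record complex (K : fieldType) (N : nat) := Complex {
  cx_rank : nat -> nat;
  cx_deg : forall i, 'I_(cx_rank i) -> nat;
  cx_aug : 'M[{mpoly K[N]}]_(1, cx_rank 0);
  cx_diff : forall i, 'M[{mpoly K[N]}]_(cx_rank i, cx_rank i.+1)
}.

(* The map \bigoplus_t R(- e t) -> \bigoplus_s R(- d s) of matrix M has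
   degree 0. *)
Definition graded_mx (K : fieldType) (N m p : nat)
    (d : 'I_m -> nat) (e : 'I_p -> nat) (M : 'M[{mpoly K[N]}]_(m, p)) : Prop :=
  forall s t, M s t = 0
    \/ (d s <= e t)%N /\ M s t \is (e t - d s)%N.-homog.

Definition graded_free_resolution (K : fieldType) (N : nat)
    (C : complex K N) (I : {mpoly K[N]} -> Prop) : Prop :=
  [/\ graded_mx (fun _ => 0%N) (@cx_deg K N C 0) (cx_aug C)
      /\ (forall i, graded_mx (@cx_deg K N C i) (@cx_deg K N C i.+1)
                      (cx_diff C i)),
      forall p, I p <-> exists v : 'cV_(cx_rank C 0), cx_aug C *m v = p%:M,
      forall v : 'cV_(cx_rank C 0),
        cx_aug C *m v = 0 <-> exists w, v = cx_diff C 0 *m w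
    & forall i (v : 'cV_(cx_rank C i.+1)),
        cx_diff C i *m v = 0 <-> exists w, v = cx_diff C i.+1 *m w].

(* The maps F_{i+1} -> F_i have all their entries in (x_0, ..., x_{N-1}). *)
Definition minimal_complex (K : fieldType) (N : nat) (C : complex K N) : Prop :=
  forall i s t, (cx_diff C i s t)@_0%MM = 0.

Definition minimal_graded_free_resolution (K : fieldType) (N : nat)
    (C : complex K N) (I : {mpoly K[N]} -> Prop) : Prop :=
  graded_free_resolution C I /\ minimal_complex C.

(* ------------------------------------------------------------------------ *)
(* The Koszul resolution of the ideal (f_b : b \in T), augmented by its map  *)
(* onto that ideal: position i has the basis e_S, S \subset T, #|S| = i + 1, *)
(* and e_S |-> \sum_(b in S) +/- f_b e_(S :\ b).                             *)
(* ------------------------------------------------------------------------ *)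

Definition koszul_basis (n : nat) (T : {set 'I_n}) (i : nat) :
    {set {set 'I_n}} :=
  [set S : {set 'I_n} | (S \subset T) && (#|S| == i.+1)].

Definition koszul_coef (K : fieldType) (N n : nat)
    (f : 'I_n -> {mpoly K[N]}) (S S' : {set 'I_n}) : {mpoly K[N]} :=
  \sum_(b in S | S :\ b == S') (-1) ^+ #|[set c in S | (c < b)%N]| * f b.

Definition koszul (K : fieldType) (N n : nat) (l : 'I_n -> nat)
    (f : 'I_n -> {mpoly K[N]}) (T : {set 'I_n}) : complex K N :=
  @Complex K N
    (fun i => #|koszul_basis T i|)
    (fun i s => (\sum_(b in enum_val s) l b)%N)
    (\row_t koszul_coef f (enum_val t) set0)
    (fun i => \matrix_(s, t) koszul_coef f (enum_val t) (enum_val s)).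

(* [alpha] is a family of degree-0 maps E_i(- dg) -> F_i that lifts the
   multiplication by the form g of degree dg. *)
Definition lifts_mul (K : fieldType) (N : nat) (g : {mpoly K[N]}) (dg : nat)
    (E F : complex K N)
    (alpha : forall i, 'M[{mpoly K[N]}]_(cx_rank F i, cx_rank E i)) : Prop :=
  [/\ forall i, graded_mx (@cx_deg K N F i)
                  (fun s => @cx_deg K N E i s + dg)%N (alpha i),
      cx_aug F *m alpha 0%N = g *: cx_aug E
    & forall i, cx_diff F i *m alpha i.+1 = alpha i *m cx_diff E i].

Section Cone.
Variables (K : fieldType) (N : nat) (g : {mpoly K[N]}) (dg : nat).
Variables E F : complex K N.
Variable alpha : forall i, 'M[{mpoly K[N]}]_(cx_rank F i, cx_rank E i).

Definition cone_rank (i : nat) : nat :=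
  if i is i'.+1 then cx_rank E i' + cx_rank F i else 1 + cx_rank F 0.

Definition cone_deg (i : nat) : 'I_(cone_rank i) -> nat :=
  match i return 'I_(cone_rank i) -> nat with
  | 0 => fun s => match split s with
                  | inl _ => dg
                  | inr t => @cx_deg K N F 0 t
                  end
  | i'.+1 => fun s => match split s with
                      | inl t => (@cx_deg K N E i' t + dg)%N
                      | inr t => @cx_deg K N F i'.+1 t
                      end
  end.

Definition cone_diff (i : nat) :
    'M[{mpoly K[N]}]_(cone_rank i, cone_rank i.+1) :=
  match i return 'M[{mpoly K[N]}]_(cone_rank i, cone_rank i.+1) with
  | 0 => block_mx (- cx_aug E) 0 (alpha 0) (cx_diff F 0)
  | i'.+1 => block_mx (- cx_diff E i') 0 (alpha i'.+1) (cx_diff F i'.+1)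
  end.

Definition mapping_cone : complex K N :=
  @Complex K N cone_rank cone_deg (row_mx g%:M (cx_aug F)) cone_diff.

End Cone.

(* 0 -> R(- dg) -> (g) -> 0 *)
Definition principal_resolution (K : fieldType) (N : nat)
    (g : {mpoly K[N]}) (dg : nat) : complex K N :=
  @Complex K N (fun i => (i == 0)%N : nat) (fun _ _ => dg) (g%:M)
    (fun _ => 0).

(* [mapping_cone_run l f s C]: C is a result of adding successively the
   generators f_k f_j, for (k, j) in s, the first one giving the initial
   resolution.  The lifts alpha are arbitrary.  E resolves the ideal
   (f_b : b > k, b != j), which is the colon ideal (I' : f_k f_j) when the
   pairs are added in the order of [cone_order] below. *)
Inductive mapping_cone_run (K : fieldType) (N n : nat) (l : 'I_n -> nat)
    (f : 'I_n -> {mpoly K[N]}) : seq ('I_n * 'I_n) -> complex K N -> Prop :=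
| Run_start k j :
    mapping_cone_run l f [:: (k, j)]
      (principal_resolution (f k * f j) (l k + l j))
| Run_step s (k j : 'I_n) (F : complex K N)
    (E := koszul l f [set b : 'I_n | (k < b)%N && (b != j)])
    (alpha : forall i, 'M[{mpoly K[N]}]_(cx_rank F i, cx_rank E i)) :
    mapping_cone_run l f s F ->
    lifts_mul (f k * f j) (l k + l j) alpha ->
    mapping_cone_run l f (rcons s (k, j))
      (mapping_cone (f k * f j) (l k + l j) alpha).

(* (n-1, n); (n-2, n), (n-2, n-1); ...; (1, n), ..., (1, 2), with the
   indices written from 1 to n. *)
Definition cone_order (n : nat) : seq ('I_n * 'I_n) :=
  [seq (k, j) | k : 'I_n <- rev (enum 'I_n),
                j : 'I_n <- [seq j : 'I_n <- rev (enum 'I_n) | (k < j)%N]].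

Definition iterated_mapping_cone (K : fieldType) (N n : nat) (l : 'I_n -> nat)
    (f : 'I_n -> {mpoly K[N]}) (C : complex K N) : Prop :=
  mapping_cone_run l f (cone_order n) C.

(* The degrees of the generators of the sum over i_1 < ... < i_{h+2} of
   R^{h+1}(- l_{i_1} - ... - l_{i_{h+2}}). *)
Definition expected_degrees (n : nat) (l : 'I_n -> nat) (h : nat) : seq nat :=
  flatten [seq nseq h.+1 (\sum_(b in B) l b)%N
          | B : {set 'I_n} <- enum [set B : {set 'I_n} | #|B| == h.+2]].

(* Main.v *)
Require Import Defs.
From mathcomp Require Import boolp ring.

(** In both cases [I] is the ideal generated by the products [f_a f_b], [a < b],
    where [f_1, ..., f_n] are the products of the rows of the matrix, and every
    subset of the [f_j] is a regular sequence, in any order.  The rest depends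
    only on this.

    Regularity.  Choosing one form in each row gives linearly independent linear
    forms, which behave as variables ([regular_family_linear]).  The property
    that each member of a family is regular modulo any set of other members
    passes to the product of two families that differ at one index
    ([regular_family_mul]), hence to the products of the rows
    ([regular_family_prods]).

    The ideal.  For a pseudo-grid, the minimal monomials of [Omega] are the
    [x_a ^ l_a x_b ^ l_b], whose liftings are the [f_a f_b].  For a grid, a
    polynomial that vanishes on a line is in the ideal of the line, the field
    being infinite ([vanishing_on_line]); the lines of direction [k] together
    give [(f_j : j != k)] ([in_span_prods]), and the intersection of these
    ideals over [k] is generated by the [f_a f_b] ([in_span_pairs]).

    The resolution.  At the stage [(k, j)] put [T = {b > k, b != j}].  The Koszul
    complex of [T] is exact by regularity ([koszul_resolution]), and
    [(I' : f_k f_j) = (f_b : b in T)] for the ideal [I'] reached so far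
    ([pair_ideal_colon], [pair_ideal_mul]); so the mapping cone resolves
    [I' + (f_k f_j)], for any choice of the lift ([mapping_cone_resolution]).

    Minimality needs an argument, because for some degrees a lift could have
    constant entries.  But [f_j] alone maps [(f_b : b in T)] into [I'], so that
    one lift of multiplication by [f_k f_j] is [f_k] times a lift of
    multiplication by [f_j], and all lifts agree modulo the maximal ideal, being
    homotopic between complexes with differentials in that ideal
    ([lift_in_maximal]).

    The degrees.  The stage [(k, j)] adds in position [h] a generator of degree
    [sum_(b in B) l_b] for each [B] of size [h + 2] that contains [k] and [j] and
    has least element [k]; each [B] is obtained [h + 1] times, once for each [j]
    in [B] other than its least element ([stage_weight_sum]). *)

Set Implicit Arguments.
Unset Strict Implicit.
Unset Printing Implicit Defensive.

Import GRing.Theory.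
Local Open Scope ring_scope.

(** * Families regular modulo their subsets *)

Definition in_span (A : comNzRingType) (J : finType) (g : J -> A)
    (T : {set J}) (p : A) : Prop :=
  exists c : J -> A, p = \sum_(b in T) c b * g b.

(** Being a nonzerodivisor modulo the ideal generated by the members of [T]. *)
Definition nzd_mod (A : comNzRingType) (J : finType) (g : J -> A)
    (T : {set J}) (z : A) : Prop :=
  forall y, in_span g T (z * y) -> in_span g T y.

Definition regular_family (A : comNzRingType) (J : finType) (g : J -> A) :
    Prop :=
  forall (T : {set J}) (b : J), b \notin T -> nzd_mod g T (g b).

Definition update (J : eqType) (X : Type) (m : J -> X) (a : J) (u : X) : J -> X :=
  fun j => if j == a then u else m j.

Definition prods (A : comNzRingType) (J : finType) (s : J -> seq A) (j : J) : A :=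
  \prod_(x <- s j) x.

Lemma in_span0 (A : comNzRingType) (J : finType) (g : J -> A) T :
  in_span g T 0.
Proof. by exists (fun=> 0); rewrite big1 // => b _; rewrite mul0r. Qed.

Lemma in_spanM (A : comNzRingType) (J : finType) (g : J -> A) T c p :
  in_span g T p -> in_span g T (c * p).
Proof.
case=> d ->; exists (fun b => c * d b).
by rewrite mulr_sumr; apply: eq_bigr => b _; rewrite mulrA.
Qed.

Lemma in_spanD (A : comNzRingType) (J : finType) (g : J -> A) T p q :
  in_span g T p -> in_span g T q -> in_span g T (p + q).
Proof.
case=> c -> [d ->]; exists (fun b => c b + d b).
by rewrite -big_split; apply: eq_bigr => b _; rewrite mulrDl.
Qed.

Lemma in_spanN (A : comNzRingType) (J : finType) (g : J -> A) T p :
  in_span g T p -> in_span g T (- p).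
Proof. by rewrite -mulN1r; apply: in_spanM. Qed.

Lemma in_spanB (A : comNzRingType) (J : finType) (g : J -> A) T p q :
  in_span g T p -> in_span g T q -> in_span g T (p - q).
Proof. by move=> hp /in_spanN; apply: in_spanD. Qed.

Lemma in_span_sum (A : comNzRingType) (J : finType) (g : J -> A) T
    (X : Type) (s : seq X) (Q : pred X) (F : X -> A) :
  (forall x, Q x -> in_span g T (F x)) ->
  in_span g T (\sum_(x <- s | Q x) F x).
Proof.
by move=> h; elim/big_ind: _ => //; [apply: in_span0 | apply: in_spanD].
Qed.

Lemma in_span_gen (A : comNzRingType) (J : finType) (g : J -> A)
    (T : {set J}) b :
  b \in T -> in_span g T (g b).
Proof.
move=> hb; exists (fun d => (d == b)%:R).
rewrite (bigD1 b) //= eqxx mul1r big1 ?addr0 // => d /andP[_ /negPf ->].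
by rewrite mul0r.
Qed.

Lemma in_span_sub (A : comNzRingType) (J J' : finType) (g : J -> A)
    (g' : J' -> A) (T : {set J}) (T' : {set J'}) p :
  (forall b, b \in T -> in_span g' T' (g b)) -> in_span g T p ->
  in_span g' T' p.
Proof.
by move=> h [c ->]; apply: in_span_sum => b /h; apply: in_spanM.
Qed.

Lemma in_span_eq (A : comNzRingType) (J : finType) (g g' : J -> A)
    (T : {set J}) p :
  {in T, g =1 g'} -> in_span g T p -> in_span g' T p.
Proof. by move=> h; apply: in_span_sub => b hb; rewrite h //; apply: in_span_gen. Qed.

Lemma in_span_set0 (A : comNzRingType) (J : finType) (g : J -> A) p :
  in_span g set0 p -> p = 0.
Proof. by case=> c ->; rewrite big_set0. Qed.

Lemma in_spanD1 (A : comNzRingType) (J : finType) (g : J -> A) (T : {set J}) a p :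
  a \in T ->
  in_span g T p <-> exists c, in_span g (T :\ a) (p - c * g a).
Proof.
move=> aT; split=> [[c ->]|[c h]].
  by exists (c a); exists c; rewrite (big_setD1 a) //= addrAC subrr add0r.
rewrite -(subrK (c * g a) p); apply: in_spanD.
  by apply: in_span_sub h => b /setD1P[_ hb]; apply: in_span_gen.
by apply/in_spanM/in_span_gen.
Qed.

(** Suppose that [g b * y = t + z u v] with [t] in the span of the other
    members of [T], [u = g1 a] and [v = g2 a].  Modulo [u] one gets
    [y = t' + w u]; then [u (g b * w - z v)] is in the span of the others, where
    [u] cancels; so [g b * w], hence [w], is in the ideal of [v] and the others,
    and [y] in that of [u v] and the others.  The cancellations
    use subsets of indices with and without [a], in no particular order: this is
    why regularity is asked of all subsets rather than along one ordering. *)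
Lemma regular_family_mul (A : comNzRingType) (J : finType) (g g1 g2 : J -> A)
    (a : J) :
  (forall j, j != a -> g1 j = g j) -> (forall j, j != a -> g2 j = g j) ->
  g a = g1 a * g2 a ->
  regular_family g1 -> regular_family g2 -> regular_family g.
Proof.
move=> e1 e2 ea r1 r2 T b bT y.
have to1 (T' : {set J}) p : a \notin T' -> in_span g T' p <-> in_span g1 T' p.
  by move=> aT; split; apply: in_span_eq => j jT; rewrite e1 //;
    apply: contraNneq aT => <-.
have to2 (T' : {set J}) p : a \notin T' -> in_span g T' p <-> in_span g2 T' p.
  by move=> aT; split; apply: in_span_eq => j jT; rewrite e2 //;
    apply: contraNneq aT => <-.
have [aT|aT] := boolP (a \in T); last first.
  have [eba|ba] := eqVneq b a.
    rewrite eba ea -mulrA => /to1-/(_ aT) h.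
    have {}h := r1 _ _ aT _ h; move/to1: h => /(_ aT)/to2-/(_ aT) h.
    by apply/to2 => //; apply: r2 aT _ h.
  by move=> /to1-/(_ aT) h; apply/to1 => //; apply: (r1 _ b) => //; rewrite e1.
have ba : b != a by apply: contraNneq bT => ->.
have bT' : b \notin T :\ a by rewrite !inE (negPf bT) andbF.
have aT' : a \notin T :\ a by rewrite !inE eqxx.
rewrite (in_spanD1 _ _ aT) ea => -[z hz].
have : in_span g1 T y.
  apply: (r1 _ _ bT); apply/(in_spanD1 _ _ aT).
  exists (z * g2 a); apply/to1 => //; rewrite e1 //.
  by rewrite -mulrA (mulrC (g2 a)).
case/(in_spanD1 _ _ aT) => w /(to1 _ _ aT') hw.
have : in_span g2 T w.
  apply: (r2 _ _ bT); apply/(in_spanD1 _ _ aT); exists z.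
  rewrite e2 //; apply/to2 => //.
  apply/to1 => //; apply: (r1 _ _ aT'); apply/to1 => //.
  have := in_spanB hz (in_spanM (g b) hw).
  set u := (X in in_span _ _ X -> _); set v := (X in _ -> in_span _ _ X).
  suff -> : u = v by [].
  by rewrite /u /v; ring.
case/(in_spanD1 _ _ aT) => z' /to2-/(_ aT') hz'.
apply/(in_spanD1 _ _ aT); exists z'.
rewrite ea.
have -> : y - z' * (g1 a * g2 a) = (y - w * g1 a) + g1 a * (w - z' * g2 a).
  by ring.
by apply: in_spanD => //; apply: in_spanM.
Qed.

(** An induction on families of nonempty lists that splits one entry off one
    list at a time, down to the families of one-element lists.  It serves
    twice: for the regularity of products and for the decomposition of the
    ideal that they generate. *)
Lemma seq_family_ind (J : finType) (T : eqType) (s : J -> seq T)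
    (P : (J -> seq T) -> Prop) :
  (forall j, s j != [::]) ->
  (forall c : J -> T, (forall j, c j \in s j) -> P (fun j => [:: c j])) ->
  (forall m a x t, (forall j, m j != [::] /\ {subset m j <= s j}) ->
     t != [::] -> subseq (x :: t) (s a) ->
     P (update m a [:: x]) -> P (update m a t) -> P (update m a (x :: t))) ->
  P s.
Proof.
move=> s0 P1 PS.
pose mix (D : seq J) (c : J -> T) j := if j \in D then s j else [:: c j].
suff H D c : (forall j, c j \in s j) -> P (mix D c).
  have c0 j : {x | x \in s j}.
    by case E: (s j) (s0 j) => [//|x t] _; exists x; rewrite inE eqxx.
  have -> : s = mix (enum J) (fun j => sval (c0 j)).
    by apply/funext => j; rewrite /mix mem_enum.
  by apply: H => j; case: (c0 j).
elim: D c => [|a D IH] c hc; first exact: P1.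
have [aD|aD] := boolP (a \in D).
  have -> : mix (a :: D) c = mix D c; last exact: IH.
  by apply/funext => j; rewrite /mix inE; case: eqP => // ->; rewrite aD.
suff H t : t != [::] -> subseq t (s a) -> P (update (mix D c) a t).
  have -> : mix (a :: D) c = update (mix D c) a (s a); last exact: H.
  by apply/funext => j; rewrite /mix /update inE; case: eqP => // ->.
elim: t => [//|x t IHt] _ sxt.
have xs : x \in s a by apply: (mem_subseq sxt); rewrite inE eqxx.
have Px : P (update (mix D c) a [:: x]).
  have -> : update (mix D c) a [:: x] = mix D (update c a x).
    apply/funext => j; rewrite /mix /update.
    by case: eqP => // ->; rewrite (negPf aD).
  by apply: IH => j; rewrite /update; case: eqP => // ->.
have [->//|t0] := eqVneq t [::].
apply: PS => // [j|].
  by rewrite /mix; case: ifP => // _; split=> // y; rewrite inE => /eqP ->.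
by apply: IHt => //; apply: subseq_trans sxt; apply: subseq_cons.
Qed.

Lemma regular_family_prods (A : comNzRingType) (J : finType) (s : J -> seq A) :
  (forall j, s j != [::]) ->
  (forall c : J -> A, (forall j, c j \in s j) -> regular_family c) ->
  regular_family (prods s).
Proof.
move=> s0 hs.
apply: (@seq_family_ind _ _ s (fun m => regular_family (prods m))) => //.
  move=> c /hs; congr regular_family; apply/funext => j.
  by rewrite /prods big_seq1.
move=> m a x t _ _ _; apply: (@regular_family_mul _ _ _ _ _ a) => [j ja|j ja|].
- by rewrite /prods /update (negPf ja).
- by rewrite /prods /update (negPf ja).
- by rewrite /prods /update eqxx big_cons big_seq1.
Qed.

Lemma nzd_mod_prod (A : comNzRingType) (J : finType) (g : J -> A) T (t : seq A) :
  (forall x, x \in t -> nzd_mod g T x) -> nzd_mod g T (\prod_(x <- t) x).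
Proof.
elim: t => [|x t IH] h y; first by rewrite big_nil mul1r.
rewrite big_cons -mulrA => hy.
apply: IH => [z zt|]; first by apply: h; rewrite inE zt orbT.
by apply: (h x) hy; rewrite inE eqxx.
Qed.

(** Membership in [(x, others)] and in [(t, others)] gives membership in
    [(x t, others)] as soon as [t] is regular modulo [(x, others)], and the
    products can be built up one entry at a time.  Two entries [x], [y] of a
    list differ by a divisor of [z]; if [y w] is in an ideal containing [x], so
    is [z w], and [z] is regular modulo all the ideals met on the way. *)
Lemma in_span_prods (A : comNzRingType) (J : finType) (s : J -> seq A)
    (k : J) (z : A) p :
  (forall j, s j != [::]) -> (forall j, uniq (s j)) ->
  (forall c : J -> A, c k = z -> (forall j, j != k -> c j \in s j) ->
     regular_family c) ->
  (forall a x y, x \in s a -> y \in s a -> x != y -> exists e, z = e * (y - x)) ->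
  (forall c : J -> A, (forall j, c j \in s j) -> in_span c [set~ k] p) ->
  in_span (prods s) [set~ k] p.
Proof.
move=> s0 us hz hd hp.
apply: (@seq_family_ind _ _ s (fun m => in_span (prods m) [set~ k] p)) => //.
  move=> c /hp; congr in_span; apply/funext => j.
  by rewrite /prods big_seq1.
move=> m a x t hm t0 sxt h1 h2.
have offa t1 t2 q : in_span (prods (update m a t1)) ([set~ k] :\ a) q ->
    in_span (prods (update m a t2)) ([set~ k] :\ a) q.
  by apply: in_span_eq => j /setD1P[/negPf ja _]; rewrite /prods /update ja.
have [eak|ak] := eqVneq a k.
  apply: in_span_eq h1 => j; rewrite eak !inE => /negPf jk.
  by rewrite /prods /update jk.
have aT : a \in [set~ k] by rewrite !inE.
(* The ideal does not see the index [k], where [z] can therefore be put: the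
   family obtained is made of products of entries and of [z]. *)
have zreg : nzd_mod (prods (update m a [:: x])) [set~ k] z.
  pose m' := update (update m a [:: x]) k [:: z].
  have e' : {in [set~ k], prods m' =1 prods (update m a [:: x])}.
    by move=> j; rewrite !inE /prods /m' {1}/update => /negPf ->.
  have -> : z = prods m' k by rewrite /prods /m' /update eqxx big_seq1.
  move=> y hy; apply: (in_span_eq e').
  have reg : regular_family (prods m').
    apply: regular_family_prods => [j|c hc].
      by rewrite /m' /update; do 2!case: ifP => // _; case: (hm j).
    apply: hz => [|j jk].
      by have := hc k; rewrite /m' /update eqxx inE => /eqP.
    have := hc j; rewrite /m' /update (negPf jk); case: eqP => [-> |_].
      by rewrite inE => /eqP ->; apply: (mem_subseq sxt); rewrite inE eqxx.
    by case: (hm j) => _; apply.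
  apply: (reg _ k); first by rewrite !inE eqxx.
  by apply: in_span_eq hy => j jT; rewrite e'.
have treg : nzd_mod (prods (update m a [:: x])) [set~ k] (\prod_(y <- t) y).
  apply: nzd_mod_prod => y yt w hw; apply: zreg.
  have xs : x \in s a by apply: (mem_subseq sxt); rewrite inE eqxx.
  have ys : y \in s a by apply: (mem_subseq sxt); rewrite inE yt orbT.
  have xy : x != y.
    have := subseq_uniq sxt (us a) => /= /andP[xt _].
    by apply: contraNneq xt => ->.
  have [e ->] := hd a x y xs ys xy.
  rewrite -mulrA mulrBl; apply/in_spanM/in_spanB => //.
  rewrite mulrC; apply: in_spanM.
  have := in_span_gen (prods (update m a [:: x])) aT.
  by rewrite {2}/prods /update eqxx big_seq1.
case/(in_spanD1 _ _ aT): h2 => c; set tp := prods _ a => hc.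
have etp : tp = \prod_(y <- t) y by rewrite /tp /prods /update eqxx.
have : in_span (prods (update m a [:: x])) [set~ k] c.
  apply: treg; rewrite mulrC -etp -[_ * _](subKr p); apply: in_spanB => //.
  by apply: in_span_sub (offa _ [:: x] _ hc) => j /setD1P[_]; apply: in_span_gen.
case/(in_spanD1 _ _ aT)=> d hd'.
apply/(in_spanD1 _ _ aT); exists d.
rewrite [prods _ a]/prods /update eqxx big_cons -etp.
have -> : p - d * (x * tp) = (p - c * tp) + tp * (c - d * x).
  by ring.
apply: in_spanD; first exact: offa hc.
apply: in_spanM; apply: (offa [:: x]).
by move: hd'; rewrite [prods _ a]/prods /update eqxx big_seq1.
Qed.

Definition pair_prod (A : comNzRingType) (J : finType) (f : J -> A)
    (u : J * J) : A := f u.1 * f u.2.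

(** If [p = sum_(j != a) c_j f_j] also lies in [(f_j : j != k)], then so does
    [c_k f_k], hence [c_k] by regularity, and [c_k f_k] is a combination of
    products [f_j f_k]. *)
Lemma in_span_pairs (A : comNzRingType) (J : finType) (f : J -> A) (a : J) p :
  regular_family f ->
  (forall k, in_span f [set~ k] p) ->
  in_span (pair_prod f) [set u : J * J | u.1 != u.2] p.
Proof.
move=> rf hp; have [c ep] := hp a.
rewrite ep; apply: in_span_sum => k; rewrite !inE => ka.
have : in_span f [set~ k] (c k).
  apply: (rf _ k); first by rewrite !inE eqxx.
  have := hp k; rewrite ep (bigD1 k) ?inE //= => h.
  rewrite mulrC -[c k * _](addrK (\sum_(i in [set~ a] | i != k) c i * f i)).
  apply: in_spanB => //; apply: in_span_sum => j /andP[_ jk].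
  by apply/in_spanM/in_span_gen; rewrite !inE.
case=> d ->; rewrite mulr_suml; apply: in_span_sum => j; rewrite !inE => jk.
rewrite -mulrA; apply: in_spanM.
by apply: (@in_span_gen _ _ (pair_prod f) _ (j, k)); rewrite inE.
Qed.

(** * Linear forms, and polynomials over an infinite field *)

(** A substitution that is the identity modulo an ideal on the variables is the
    identity modulo this ideal on all polynomials; to show that [p] is in the
    ideal, it then suffices that the substitution kills [p]. *)
Lemma comp_mpoly_in_span (K : fieldType) (N : nat) (J : finType)
    (g : J -> {mpoly K[N]}) (T : {set J}) (lq : N.-tuple {mpoly K[N]}) :
  (forall i, in_span g T (tnth lq i - 'X_i)) ->
  forall p, in_span g T (p \mPo lq - p).
Proof.
move=> h p.
have hM q1 q2 : in_span g T (q1 \mPo lq - q1) -> in_span g T (q2 \mPo lq - q2) ->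
    in_span g T ((q1 * q2) \mPo lq - q1 * q2).
  move=> h1 h2.
  have -> : (q1 * q2) \mPo lq - q1 * q2
      = (q1 \mPo lq) * (q2 \mPo lq - q2) + q2 * (q1 \mPo lq - q1).
    by rewrite rmorphM /=; ring.
  by apply: in_spanD; apply: in_spanM.
have h1 : in_span g T (1 \mPo lq - 1).
  by rewrite comp_mpoly1 subrr; apply: in_span0.
rewrite {2}[p]mpolyE comp_mpolyEX -sumrB; apply: in_span_sum => m _.
rewrite -scalerBr -mul_mpolyC; apply: in_spanM.
rewrite mpolyXE_id; elim/big_rec: _ => // i q _ hq; apply: (hM) => //.
elim: (m i) => [|k IH]; first by rewrite expr0.
by rewrite exprS; apply: (hM) => //; rewrite comp_mpolyXU -tnth_nth.
Qed.

Lemma dhomog1E (K : fieldType) (N : nat) (u : {mpoly K[N]}) :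
  u \is 1.-homog -> u = \sum_i u@_U_(i) *: 'X_i.
Proof.
move=> hu; apply/mpolyP => m; rewrite raddf_sum /=.
have [/existsP[i /eqP ->]|hm] := boolP [exists i, m == U_(i)%MM].
  rewrite (bigD1 i) //= mcoeffZ mcoeffXU eqxx mulr1 big1 ?addr0 // => j ji.
  by rewrite mcoeffZ mcoeffXU (negPf ji) mulr0.
rewrite (dhomog_nemf_coeff hu) /=; last by rewrite mdeg_eq1.
rewrite big1 // => i _; rewrite mcoeffZ mcoeffX.
case: eqP => [ei|]; last by rewrite mulr0.
by case/existsP: hm; exists i; rewrite ei.
Qed.

Lemma dhomogXU (K : fieldType) (N : nat) (i : 'I_N) :
  ('X_i : {mpoly K[N]}) \is 1.-homog.
Proof. by rewrite dhomogX /= mdeg1. Qed.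

Lemma linear_form_sum (K : fieldType) (n : nat) (J : finType) (T : {set J})
    (c : J -> K) (v : J -> linear_form K n) :
  mpoly_of_dhomog (\sum_(j in T) c j *: v j)
  = \sum_(j in T) c j *: mpoly_of_dhomog (v j).
Proof. by rewrite raddf_sum /=; apply: eq_bigr. Qed.

Lemma free_family (K : fieldType) (V : vectType K) (J : finType) (v : J -> V) :
  free [seq v j | j <- enum J] ->
  forall c : J -> K, \sum_j c j *: v j = 0 -> forall j, c j = 0.
Proof.
move=> /(@freeP _ _ _ (in_tuple _)) h c hc j.
have sz : size [seq v j | j <- enum J] = #|J| by rewrite size_map -cardE.
pose k (i : 'I_(size [seq v j | j <- enum J])) := c (enum_val (cast_ord sz i)).
have -> : c j = k (cast_ord (esym sz) (enum_rank j)).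
  by rewrite /k cast_ordKV enum_rankK.
apply: h; rewrite -[RHS]hc [RHS](reindex (fun i => enum_val (cast_ord sz i))) /=.
  apply: eq_bigr => i _; rewrite /k; congr (_ *: _).
  by rewrite (nth_map j) ?(enum_val_nth j) // -cardE -sz.
exists (fun j => cast_ord (esym sz) (enum_rank j)) => i _.
  by rewrite enum_valK cast_ordK.
by rewrite cast_ordKV enum_rankK.
Qed.

(** Modulo the forms indexed by [T], every polynomial is congruent to its
    image under the substitution [x_i -> x_i - pi(x_i)], where [pi] projects
    the linear forms onto the span [U] of these forms.  The substitution sends
    the forms of [T] to zero but not [v b], by freeness; as polynomials over a
    field have no divisors of zero, it follows that [v b] is regular. *)
Lemma regular_family_linear (K : fieldType) (n : nat) (J : finType)
    (v : J -> linear_form K n) :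
  (forall c : J -> K, \sum_j c j *: v j = 0 -> forall j, c j = 0) ->
  regular_family (fun j => mpoly_of_dhomog (v j)).
Proof.
move=> fv T b bT y.
set g := fun j => _.
pose U : {vspace linear_form K n} := (\sum_(j in T) <[v j]>)%VS.
have UP u : u \in U -> exists c : J -> K, u = \sum_(j in T) c j *: v j.
  move=> /memv_sumP[w hw ->].
  have hc j : {c | j \in T -> w j = c *: v j}.
    by case: (boolP (j \in T)) => [/hw/vlineP/cid[c ->]|_]; [exists c | exists 0].
  exists (fun j => sval (hc j)); apply: eq_bigr => j jT.
  by case: (hc j) => /= c ->.
pose X i : linear_form K n := DHomog (dhomogXU K i).
pose lq := [tuple mpoly_of_dhomog (X i - projv U (X i)) | i < n.+1].
pose phi p := p \mPo lq.
have phiP p : in_span g T (phi p - p).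
  apply: comp_mpoly_in_span => i; rewrite tnth_mktuple raddfB /= addrC addKr.
  apply: in_spanN.
  have [c ->] := UP _ (memv_proj U (X i)).
  rewrite linear_form_sum; apply: in_span_sum => j jT.
  by rewrite -mul_mpolyC; apply/in_spanM/(in_span_gen g).
have phi_lin (u : linear_form K n) :
    phi (mpoly_of_dhomog u) = mpoly_of_dhomog (u - projv U u).
  have eu : u = \sum_i (mpoly_of_dhomog u)@_U_(i) *: X i.
    apply/val_inj => /=; rewrite {1}[mpoly_of_dhomog u]dhomog1E ?dhomog_is_dhomog //.
    by rewrite raddf_sum /=; apply: eq_bigr.
  have -> : u - projv U u = \sum_i (mpoly_of_dhomog u)@_U_(i) *: (X i - projv U (X i)).
    rewrite [in LHS]eu linear_sum -sumrB; apply: eq_bigr => i _.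
    by rewrite linearZ scalerBr.
  rewrite {1}[mpoly_of_dhomog u]dhomog1E ?dhomog_is_dhomog // /phi !raddf_sum /=.
  apply: eq_bigr => i _; rewrite comp_mpolyZ comp_mpolyXU -tnth_nth tnth_mktuple.
  by rewrite raddfB.
have phi0 p : in_span g T p -> phi p = 0.
  case=> c ->; rewrite /phi rmorph_sum big1 //= => j jT.
  rewrite rmorphM /= [X in _ * X](_ : _ = 0) ?mulr0 //.
  rewrite [LHS](phi_lin (v j)) projv_id ?subrr ?raddf0 //.
  by apply: (subvP (sumv_sup j _ (subvv _))) => //; apply: memv_line.
move=> /phi0; rewrite /phi rmorphM => /eqP; rewrite mulf_eq0 => /orP[] /eqP hy.
  have /UP[c hc] : v b \in U.
    have hb := etrans (esym (phi_lin (v b))) hy.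
    have /eqP : v b - projv U (v b) = 0 by apply/val_inj.
    by rewrite subr_eq0 => /eqP ->; apply: memv_proj.
  pose d j := if j == b then 1 else if j \in T then - c j else 0.
  suff d0 : \sum_j d j *: v j = 0.
    by have /eqP := fv d d0 b; rewrite /d eqxx oner_eq0.
  rewrite (bigD1 b) //= {1}/d eqxx scale1r hc big_mkcond /=.
  rewrite [X in X + _](bigD1 b) //= (negPf bT) add0r -big_split big1 //= => j jb.
  by rewrite /d (negPf jb); case: ifP; rewrite ?scaleNr ?subrr // scale0r addr0.
have := phiP y; rewrite /phi hy sub0r => /in_spanN; by rewrite opprK.
Qed.

Lemma infinite_field_uniq (K : fieldType) : infinite_field K ->
  forall d, exists s : seq K, uniq s /\ size s = d.
Proof.
move=> infK; elim=> [|d [s [us ss]]]; first by exists [::].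
have [x xs] : exists x : K, x \notin s.
  apply: contrapT => h; apply: infK; apply/cardinality.finite_seqP; exists s.
  apply/funext => x /=; apply/propext; split=> // _.
  by apply: contrapT => /negP hx; apply: h; exists x.
by exists (x :: s); rewrite /= xs us ss.
Qed.

Lemma poly_vanishing (K : fieldType) (q : {poly K}) : infinite_field K ->
  (forall x, q.[x] = 0) -> q = 0.
Proof.
move=> infK hq; have [s [us ss]] := infinite_field_uniq infK (size q).
apply: contrapT => /eqP q0.
have rs : all (root q) s by apply/allP => x _; rewrite rootE hq.
by have := max_poly_roots q0 rs us; rewrite ss ltnn.
Qed.

(** Induction on the number of variables: with the other variables evaluated,
    [p] is a polynomial in the last one with infinitely many roots, so that its
    coefficients vanish at all points. *)
Lemma mpoly_vanishing (K : fieldType) (n : nat) (p : {mpoly K[n]}) :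
  infinite_field K -> (forall v : 'I_n -> K, p.@[v] = 0) -> p = 0.
Proof.
move=> infK; elim: n p => [|n IH] p hp.
  have := hp (fun=> 0); rewrite mevalE => h; apply/mpolyP => m.
  rewrite mcoeff0 [p]mpolyE raddf_sum /= -[RHS]h; apply: eq_bigr => m' _.
  by rewrite mcoeffZ mcoeffX big_ord0; congr (_ * _); case: eqP => // -[];
    apply/mnmP => -[].
have um : muni p = 0.
  apply/polyP => i; rewrite coef0; apply: IH => v.
  pose q : {poly K} := map_poly (meval v) (muni p).
  have -> : ((muni p)`_i).@[v] = q`_i by rewrite coef_map.
  rewrite (_ : q = 0) ?coef0 //; apply: poly_vanishing => // t.
  pose w (j : 'I_n.+1) := if unlift ord_max j is Some j' then v j' else t.
  rewrite -(hp w) mevalE /q muniE raddf_sum horner_sum; apply: eq_bigr => m _.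
  rewrite /= map_polyZ /= map_polyXn hornerZ hornerXn mevalZ mevalX -mulrA.
  rewrite big_ord_recr /= {2}/w unlift_none; congr (_ * (_ * _)).
  apply: eq_bigr => j _; rewrite mnmE; congr (_ ^+ _).
  have -> : widen_ord (leqnSn n) j = lift ord_max j.
    by apply/val_inj; rewrite /= /bump leqNgt ltn_ord.
  by rewrite /w liftK.
apply/mpolyP => m; rewrite mcoeff0.
pose low (m : 'X_{1..n.+1}) := [multinom m (widen_ord (leqnSn n) i) | i < n].
have := congr1 (fun q : {poly {mpoly K[n]}} => (q`_(m ord_max))@_(low m)) um.
rewrite muniE coef0 mcoeff0 => <-.
rewrite coef_sum raddf_sum {1}[p]mpolyE raddf_sum /=; apply: eq_bigr => m0 _.
rewrite mcoeffZ mcoeffX coefZ coefXn mulr_natr.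
have -> : (m0 == m) = (m ord_max == m0 ord_max) && (low m0 == low m).
  apply/eqP/andP => [-> //|[/eqP e1 /eqP e2]]; apply/mnmP => i.
  case: (unliftP ord_max i) => [j|] -> //.
  have -> : lift ord_max j = widen_ord (leqnSn n) j.
    by apply/val_inj; rewrite /= /bump leqNgt ltn_ord.
  by have /mnmP/(_ j) := e2; rewrite !mnmE.
case: (_ == _) => /=; last by rewrite mulr0 mcoeff0.
by rewrite mulr1n mcoeffZ mcoeffX.
Qed.

(** * Exactness of the Koszul complex *)

(** The Koszul differential on the subsets of [T], a chain being the function
    [v] of its coefficients: the value at [S] is the coefficient of [e_S] in the
    boundary of [sum_S' v(S') e_S'].  As no condition is put on the support of
    [v], the chains of all positions are handled together, and the position
    appears only as the cardinal of [S]. *)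
Definition kdiff (A : comNzRingType) (n : nat) (f : 'I_n -> A) (T : {set 'I_n})
    (v : {set 'I_n} -> A) (S : {set 'I_n}) : A :=
  \sum_(b in T :\: S) (-1) ^+ #|[set c in S | (c < b)%N]| * f b * v (b |: S).

Lemma eq_kdiff (A : comNzRingType) (n : nat) (f : 'I_n -> A)
    (T : {set 'I_n}) v w (S : {set 'I_n}) d :
  (forall S' : {set 'I_n}, S' \subset T -> #|S'| = d.+1 -> v S' = w S') ->
  S \subset T -> #|S| = d -> kdiff f T v S = kdiff f T w S.
Proof.
move=> h ST dS; apply: eq_bigr => b /setDP[bT bS].
by rewrite h ?subUset ?sub1set ?bT // cardsU1 bS dS.
Qed.

Lemma kdiff_lin (A : comNzRingType) (n : nat) (f : 'I_n -> A) T a v w S :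
  kdiff f T (fun S => a * v S + w S) S = a * kdiff f T v S + kdiff f T w S.
Proof.
rewrite mulr_sumr -big_split; apply: eq_bigr => b _ /=.
by ring.
Qed.

Lemma kdiffN (A : comNzRingType) (n : nat) (f : 'I_n -> A) T v S :
  kdiff f T (fun S => - v S) S = - kdiff f T v S.
Proof. by rewrite -sumrN; apply: eq_bigr => b _; rewrite mulrN. Qed.

(** The least index of [T] contributes no sign where it is absent and changes
    all the signs where it is present.  So the differential of [T] is that of
    the mapping cone of multiplication by [f b] on the complex of [T :\ b]. *)
Lemma kdiff_notin (A : comNzRingType) (n : nat) (f : 'I_n -> A)
    (T : {set 'I_n}) (b : 'I_n) (v : {set 'I_n} -> A) (S : {set 'I_n}) :
  b \in T -> (forall c, c \in T -> (b <= c)%N) -> S \subset T :\ b ->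
  kdiff f T v S = f b * v (b |: S) + kdiff f (T :\ b) v S.
Proof.
move=> bT bmin ST; have bS : b \notin S.
  by apply: contraTN ST => bS; apply/subsetPn; exists b; rewrite // !inE eqxx.
rewrite /kdiff (bigD1 b) ?inE ?bT ?bS //=; congr (_ + _).
  rewrite [[set c in S | _]](_ : _ = set0) ?cards0 ?mul1r //.
  apply/setP => c; rewrite !inE; apply/negP => /andP[cS].
  by have /setD1P[_ /bmin] := subsetP ST _ cS; rewrite leqNgt => /negP.
by apply: eq_bigl => c; rewrite !inE andbC andbCA andbA.
Qed.

Lemma kdiff_in (A : comNzRingType) (n : nat) (f : 'I_n -> A)
    (T : {set 'I_n}) (b : 'I_n) (v : {set 'I_n} -> A) (S : {set 'I_n}) :
  b \in T -> (forall c, c \in T -> (b <= c)%N) -> S \subset T :\ b ->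
  kdiff f T v (b |: S) = - kdiff f (T :\ b) (fun S => v (b |: S)) S.
Proof.
move=> bT bmin ST; have bS : b \notin S.
  by apply: contraTN ST => bS; apply/subsetPn; exists b; rewrite // !inE eqxx.
rewrite /kdiff -sumrN; apply: eq_big => [c|c].
  by rewrite !inE negb_or -andbA andbCA andbC -!andbA; congr (_ && _); rewrite andbC.
rewrite !inE negb_or => /andP[/andP[cb cS] cT].
have bc : (b < c)%N.
  by rewrite ltn_neqAle bmin // andbT eq_sym.
rewrite setUCA -!mulNr; congr (_ * _ * _).
have -> : [set d in b |: S | (d < c)%N] = b |: [set d in S | (d < c)%N].
  apply/setP => d; rewrite !inE andb_orl; congr (_ || _).
  by case: eqP => // ->.
by rewrite cardsU1 !inE (negPf bS) /= exprS mulN1r.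
Qed.

Lemma set_peel (n : nat) (P : {set 'I_n} -> Prop) :
  P set0 ->
  (forall (T : {set 'I_n}) (b : 'I_n), b \in T ->
     (forall c, c \in T -> (b <= c)%N) -> P (T :\ b) -> P T) ->
  forall T, P T.
Proof.
move=> P0 PS T; have [m] := ubnP #|T|; elim: m T => // m IH T.
have [-> //|[i0 i0T]] := set_0Vmem T; rewrite ltnS => hT.
case: (@arg_minnP _ i0 (mem T) (@nat_of_ord n)) => // b bT bmin.
apply: (PS _ b) => //; apply: IH; apply: leq_trans hT.
by rewrite [X in (_ < X)%N](cardsD1 b) [b \in T]bT.
Qed.

Lemma subset_peel (n : nat) (T S : {set 'I_n}) b : S \subset T -> b \in S ->
  exists2 S' : {set 'I_n}, S' \subset T :\ b & S = b |: S' /\ b \notin S'.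
Proof.
move=> ST bS; exists (S :\ b); first exact: setSD.
by rewrite setD1K // !inE eqxx.
Qed.

Lemma kdiffK (A : comNzRingType) (n : nat) (f : 'I_n -> A) (T : {set 'I_n})
    (w : {set 'I_n} -> A) (S : {set 'I_n}) :
  S \subset T -> kdiff f T (kdiff f T w) S = 0.
Proof.
elim/set_peel: T w S => [|T b bT bmin IH] w S ST.
  by rewrite /kdiff big1 // => b; rewrite !inE andbF.
have inb (S0 : {set 'I_n}) : S0 \subset T :\ b ->
    kdiff f T w (b |: S0) = - kdiff f (T :\ b) (fun S => w (b |: S)) S0.
  by move=> S0T; apply: kdiff_in.
have [bS|bS] := boolP (b \in S).
  have [S' S'T [-> bS']] := subset_peel ST bS.
  rewrite kdiff_in //.
  rewrite (@eq_kdiff _ _ _ _ _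
      (fun S => - kdiff f (T :\ b) (fun S => w (b |: S)) S) _ #|S'|) //.
    by rewrite kdiffN IH ?oppr0.
  by move=> S0 S0T _; apply: inb.
have {}ST : S \subset T :\ b by rewrite subsetD1 ST.
rewrite (kdiff_notin _ _ bT) // inb //.
rewrite [X in _ + X](@eq_kdiff _ _ _ (T :\ b) _
    (fun S => f b * w (b |: S) + kdiff f (T :\ b) w S) _ #|S|) //.
  by rewrite kdiff_lin IH // addr0 mulrN addrC subrr.
by move=> S0 S0T _; apply: kdiff_notin.
Qed.

(** Peel off the least index [b] of [T].  A cycle is [v0 + e_b v1]; the
    component [v1] is a boundary, by induction in positive degree and in degree
    zero because [f b] is regular modulo the other forms.  Subtracting a
    boundary, one is left with a cycle that does not involve [b]. *)
Lemma kdiff_exact (A : comNzRingType) (n : nat) (f : 'I_n -> A) :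
  regular_family f -> forall (T : {set 'I_n}) (d : nat) (v : {set 'I_n} -> A),
  (forall S : {set 'I_n}, S \subset T -> #|S| = d -> kdiff f T v S = 0) ->
  exists w, forall S : {set 'I_n}, S \subset T -> #|S| = d.+1 ->
    v S = kdiff f T w S.
Proof.
move=> rf; elim/set_peel => [|T b bT bmin IH] d v hv.
  by exists v => S; rewrite subset0 => /eqP ->; rewrite cards0.
set T' := T :\ b in IH.
have subT (S : {set 'I_n}) : S \subset T' -> S \subset T /\ b \notin S.
  by rewrite subsetD1 => /andP[].
have [w1 hw1] : exists w1, forall S : {set 'I_n}, S \subset T' -> #|S| = d ->
    v (b |: S) = kdiff f T' w1 S.
  case: d hv => [|d] hv.
    have h0 := hv set0 (sub0set _) (cards0 _).
    rewrite (kdiff_notin _ _ bT bmin) ?sub0set // in h0.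
    have [a ha] : in_span f T' (v (b |: set0)).
      (* The cycle condition here is [f b * v {b} + sum_c f c * v {c} = 0]. *)
      apply: (rf _ b); first by rewrite !inE eqxx.
      rewrite -[_ * _](addrK (kdiff f (T :\ b) v set0)) h0 sub0r.
      apply/in_spanN/in_span_sum => c; rewrite setD0 => cT.
      by rewrite mulrAC; apply/in_spanM/in_span_gen.
    exists (fun S : {set 'I_n} => \sum_(c in S) a c) => S _ /eqP; rewrite cards_eq0 => /eqP ->.
    rewrite ha /kdiff setD0; apply: eq_bigr => c _.
    rewrite setU0 big_set1 [[set _ in _ | _]](_ : _ = set0) ?cards0 ?mul1r 1?mulrC //.
    by apply/setP => e; rewrite !inE.
  apply: IH => S ST' dS; have [ST bS] := subT _ ST'.
  apply: oppr_inj; rewrite -kdiff_in // oppr0; apply: hv.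
    by rewrite subUset sub1set bT.
  by rewrite cardsU1 bS dS.
have [w0 hw0] : exists w0, forall S : {set 'I_n}, S \subset T' -> #|S| = d.+1 ->
    f b * w1 S + v S = kdiff f T' w0 S.
  apply: IH => S ST' dS; have [ST bS] := subT _ ST'.
  by rewrite kdiff_lin -hw1 // -kdiff_notin // hv.
exists (fun S : {set 'I_n} => if b \in S then - w1 (S :\ b) else w0 S) => S ST dS.
have [bS|bS] := boolP (b \in S).
  have [S' S'T [eS bS']] := subset_peel ST bS.
  have dS' : #|S'| = d by move: dS; rewrite eS cardsU1 bS' => -[].
  rewrite eS kdiff_in // hw1 //.
  rewrite -kdiffN; apply: (@eq_kdiff _ _ _ _ _ _ _ d) => // S0 S0T _.
  have [_ bS0] := subT _ S0T.
  by rewrite setU11 opprK setU1K.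
have ST' : S \subset T' by rewrite subsetD1 ST.
rewrite (kdiff_notin _ _ bT) // setU11 setU1K // mulrN.
rewrite [X in _ + X](@eq_kdiff _ _ _ T' _ w0 _ d.+1) //.
  by rewrite -hw0 // addrA addNr add0r.
by move=> S0 S0T _; have [_ /negPf ->] := subT _ S0T.
Qed.

Lemma koszul_kdiff (K : fieldType) (N n : nat) (f : 'I_n -> {mpoly K[N]})
    (T S : {set 'I_n}) i (v : {set 'I_n} -> {mpoly K[N]}) :
  S \subset T -> #|S| = i ->
  \sum_(S' in koszul_basis T i) koszul_coef f S' S * v S' = kdiff f T v S.
Proof.
move=> ST dS; rewrite /koszul_coef.
under eq_bigr => S' _ do rewrite mulr_suml.
rewrite (exchange_big_dep predT) //= /kdiff [RHS]big_mkcond; apply: eq_bigr => b _ /=.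
case: ifP => [/setDP[bT bS]|hb].
  rewrite (big_pred1 (b |: S)) => [|S'].
    congr (_ ^+ _ * _ * _); apply: eq_card => c; rewrite !inE.
    by case: (eqVneq c b) => [->|] //=; rewrite ltnn andbF.
  apply/and3P/eqP => [[_ bS' /eqP <-]|->]; first by rewrite setD1K.
  by rewrite setU1K // setU11 inE cardsU1 bS dS subUset sub1set bT ST !eqxx.
rewrite big_pred0 // => S'; apply: contraFF hb => /and3P[].
rewrite !inE => /andP[/subsetP S'T _] bS' /eqP <-.
by rewrite !inE eqxx S'T.
Qed.

Lemma col_of_sets (A : nzRingType) (n : nat) (B : {set {set 'I_n}})
    (v : 'cV[A]_#|B|) :
  exists vf : {set 'I_n} -> A, v = \col_s vf (enum_val s).
Proof.
exists (fun S => if [pick s | enum_val s == S] is Some s then v s 0 else 0).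
apply/colP => s; rewrite mxE; case: pickP => [t /eqP/enum_val_inj -> //|].
by move/(_ s); rewrite eqxx.
Qed.

(** This equivalence is exactness of the Koszul complex of [T] at once in all
    positive positions and, for [i = 0], at the end augmented by [R]. *)
Lemma koszul_exact (K : fieldType) (N n : nat) (f : 'I_n -> {mpoly K[N]})
    (T : {set 'I_n}) i (v : {set 'I_n} -> {mpoly K[N]}) :
  regular_family f ->
  (forall S : {set 'I_n}, S \subset T -> #|S| = i ->
     \sum_(S' in koszul_basis T i) koszul_coef f S' S * v S' = 0) <->
  exists w, forall S, S \in koszul_basis T i ->
     v S = \sum_(S' in koszul_basis T i.+1) koszul_coef f S' S * w S'.
Proof.
move=> rf; split=> [h|[w hw] S ST dS].
  have [|w hw] := kdiff_exact rf (T := T) (d := i) (v := v).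
    by move=> S ST dS; rewrite -(koszul_kdiff f v ST dS) h.
  exists w => S; rewrite inE => /andP[ST /eqP dS].
  by rewrite hw // (koszul_kdiff _ _ ST dS).
rewrite (koszul_kdiff _ _ ST dS) -[RHS](kdiffK f w ST).
apply: eq_kdiff ST dS => S' S'T dS'; rewrite hw ?inE ?S'T ?dS' ?eqxx //.
exact: koszul_kdiff.
Qed.

Lemma koszul_resolution (K : fieldType) (N n : nat) (l : 'I_n -> nat)
    (f : 'I_n -> {mpoly K[N]}) (T : {set 'I_n}) :
  (forall b, f b \is (l b).-homog) -> regular_family f ->
  graded_free_resolution (koszul l f T) (in_span f T).
Proof.
move=> hf rf.
have coefG (S S' : {set 'I_n}) : koszul_coef f S S' = 0 \/
    (\sum_(b in S') l b <= \sum_(b in S) l b)%N /\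
    koszul_coef f S S' \is (\sum_(b in S) l b - \sum_(b in S') l b)%N.-homog.
  have [/existsP[b /andP[bS /eqP eS]]|hb] :=
      boolP [exists b, (b \in S) && (S :\ b == S')]; last first.
    left; rewrite /koszul_coef big_pred0 // => b.
    by apply/negP => hb'; case/negP: hb; apply/existsP; exists b.
  have eS1 : (\sum_(c in S) l c = l b + \sum_(c in S :\ b) l c)%N.
    by rewrite (big_setD1 b).
  right; rewrite -eS eS1 leq_addl addnK; split=> //.
  rewrite /koszul_coef; apply: rpred_sum => c /andP[cS /eqP eS'].
  have -> : c = b.
    have : c \notin S :\ b by rewrite -eS' !inE eqxx.
    by rewrite !inE cS andbT negbK => /eqP.
  by rewrite -[l b]add0n; apply: dhomogM => //;
    rewrite -signr_odd; case: odd; rewrite ?expr1 ?expr0 ?rpredN dhomog1.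
have sub (i : nat) (s : 'I_#|koszul_basis T i|) :
    enum_val s \subset T /\ #|enum_val s| = i.+1.
  by have := enum_valP s; rewrite inE => /andP[-> /eqP].
have mulE i (v : {set 'I_n} -> {mpoly K[N]}) (S : {set 'I_n}) :
   \sum_(t < #|koszul_basis T i|) koszul_coef f (enum_val t) S
      * (\col_t v (enum_val t)) t (0 : 'I_1)
   = \sum_(S' in koszul_basis T i) koszul_coef f S' S * v S'.
  rewrite [RHS]big_enum_val; apply: eq_bigr => t _; by rewrite mxE.
have only0 (S : {set 'I_n}) : #|S| = 0%N -> S = set0.
  by move/eqP; rewrite cards_eq0 => /eqP.
split.
- split=> [s t|i s t].
    by rewrite mxE; have := coefG (enum_val t) set0; rewrite big_set0.
  by rewrite mxE; apply: coefG.
- move=> p; split=> [[c ->]|[v]].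
    pose cs (S : {set 'I_n}) := \sum_(b in S) c b.
    exists (\col_(s < #|koszul_basis T 0|) cs (enum_val s)).
    apply/rowP => j; rewrite !mxE ord1 mulr1n.
    transitivity (kdiff f T cs set0); last first.
      rewrite /kdiff setD0; apply: eq_bigr => b _.
      rewrite /cs setU0 big_set1 mulrC [[set _ in _ | _]](_ : _ = set0).
        by rewrite cards0 mul1r.
      by apply/setP => e; rewrite !inE.
    rewrite -(koszul_kdiff _ _ (sub0set _) (cards0 _)) -mulE.
    by apply: eq_bigr => s _; rewrite !mxE.
  have [vf ->] := col_of_sets v => /rowP/(_ 0); rewrite !mxE mulr1n => <-.
  under eq_bigr => s _ do rewrite mxE.
  rewrite mulE (koszul_kdiff _ _ (sub0set _) (cards0 _)) /kdiff setD0.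
  apply: in_span_sum => b bT.
  by rewrite mulrAC; apply/in_spanM/in_span_gen.
- move=> v; have [vf ->] := col_of_sets v.
  have := koszul_exact T 0 vf rf => -[h1 h2]; split=> [hv|[w hw]].
    case: h1 => [S ST dS|w hw].
      rewrite -mulE (only0 _ dS); move/rowP/(_ 0): hv; rewrite !mxE => hv.
      by rewrite -[RHS]hv; apply: eq_bigr => s _; rewrite !mxE.
    exists (\col_s w (enum_val s)); apply/colP => s; rewrite !mxE hw ?enum_valP //.
    by rewrite -mulE; apply: eq_bigr => t _; rewrite !mxE.
  apply/rowP => j; rewrite !mxE ord1.
  transitivity (\sum_(S' in koszul_basis T 0) koszul_coef f S' set0 * vf S').
    by rewrite -mulE; apply: eq_bigr => s _; rewrite !mxE.
  apply: h2 (sub0set _) (cards0 _).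
  have [wf ew] := col_of_sets w; exists wf => S ST.
  have := congr1 (fun M : 'cV_ _ => M (enum_rank_in ST S) 0) hw.
  rewrite !mxE enum_rankK_in // => ->.
  by rewrite -mulE ew; apply: eq_bigr => t _; rewrite !mxE enum_rankK_in.
- move=> i v; have [vf ->] := col_of_sets v.
  have := koszul_exact T i.+1 vf rf => -[h1 h2]; split=> [hv|[w hw]].
    case: h1 => [S ST dS|w hw].
      have SB : S \in koszul_basis T i by rewrite inE ST dS /=.
      have := congr1 (fun M : 'cV_ _ => M (enum_rank_in SB S) 0) hv.
      rewrite -mulE !mxE => h; rewrite -[RHS]h; apply: eq_bigr => t _.
      by rewrite !mxE enum_rankK_in.
    exists (\col_s w (enum_val s)); apply/colP => s; rewrite !mxE hw ?enum_valP //.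
    by rewrite -mulE; apply: eq_bigr => t _; rewrite !mxE.
  apply/colP => s; rewrite !mxE.
  have [sT ds] := sub _ s.
  transitivity (\sum_(S' in koszul_basis T i.+1) koszul_coef f S' (enum_val s) * vf S').
    by rewrite -mulE; apply: eq_bigr => t _; rewrite !mxE.
  apply: h2 sT ds.
  have [wf ew] := col_of_sets w; exists wf => S ST.
  have := congr1 (fun M : 'cV_ _ => M (enum_rank_in ST S) 0) hw.
  rewrite !mxE enum_rankK_in // => ->.
  by rewrite -mulE ew; apply: eq_bigr => t _; rewrite !mxE enum_rankK_in.
Qed.

(** * Graded lifts and mapping cones *)

(** An entry of a degree-0 map [R(- e) -> R(- d)]. *)
Definition graded_entry (K : fieldType) (N : nat) (d e : nat)
    (p : {mpoly K[N]}) : Prop :=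
  p = 0 \/ (d <= e)%N /\ p \is (e - d)%N.-homog.

Lemma graded_entryD (K : fieldType) (N d e : nat) (p q : {mpoly K[N]}) :
  graded_entry d e p -> graded_entry d e q -> graded_entry d e (p + q).
Proof.
case=> [->|[de hp]]; first by rewrite add0r.
case=> [->|[_ hq]]; first by rewrite addr0; right.
by right; split=> //; apply: dhomogD.
Qed.

Lemma graded_entryN (K : fieldType) (N d e : nat) (p : {mpoly K[N]}) :
  graded_entry d e p -> graded_entry d e (- p).
Proof.
case=> [->|[de hp]]; first by rewrite oppr0; left.
by right; rewrite rpredN.
Qed.

Lemma graded_entryM (K : fieldType) (N d e h : nat) (p q : {mpoly K[N]}) :
  graded_entry d e p -> graded_entry e h q -> graded_entry d h (p * q).
Proof.
case=> [->|[de hp]]; first by rewrite mul0r; left.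
case=> [->|[eh hq]]; first by rewrite mulr0; left.
right; split; first exact: leq_trans eh.
have -> : (h - d)%N = ((e - d) + (h - e))%N by rewrite addnC addnBA // subnK.
exact: dhomogM.
Qed.

Lemma graded_entry_shift (K : fieldType) (N d e a : nat) (p : {mpoly K[N]}) :
  graded_entry d e p -> graded_entry (d + a) (e + a) p.
Proof.
by case=> [->|[de hp]]; [left | right; rewrite leq_add2r subnDr].
Qed.

Lemma graded_mx_mul (K : fieldType) (N m p q : nat) (d : 'I_m -> nat)
    (e : 'I_p -> nat) (h : 'I_q -> nat) (A : 'M[{mpoly K[N]}]_(m, p)) B :
  graded_mx d e A -> graded_mx e h B -> graded_mx d h (A *m B).
Proof.
move=> gA gB s t; rewrite mxE -/(graded_entry _ _ _).
apply: (big_ind (graded_entry _ _)) => [|x y|u _]; first by left.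
  exact: graded_entryD.
exact: graded_entryM (gA s u) (gB u t).
Qed.

Definition graded_part (K : fieldType) (N : nat) (d e : nat)
    (p : {mpoly K[N]}) : {mpoly K[N]} :=
  if (d <= e)%N then pihomog mdeg (e - d) p else 0.

Lemma graded_partP (K : fieldType) (N d e : nat) (p : {mpoly K[N]}) :
  graded_entry d e (graded_part d e p).
Proof.
by rewrite /graded_part; case: ifP => de; [right; split=> //; apply: pihomogP | left].
Qed.

Lemma graded_part_id (K : fieldType) (N d e : nat) (p : {mpoly K[N]}) :
  graded_entry d e p -> graded_part d e p = p.
Proof.
rewrite /graded_part; case=> [->|[-> hp]]; last exact: pihomog_dE.
by case: ifP => // _; rewrite pihomog0.
Qed.

Lemma graded_part_sum (K : fieldType) (N d e : nat) (X : finType)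
    (F : X -> {mpoly K[N]}) :
  graded_part d e (\sum_x F x) = \sum_x graded_part d e (F x).
Proof.
rewrite /graded_part; case: ifP => _; last by rewrite big1.
by rewrite raddf_sum.
Qed.

Lemma pihomogM (K : fieldType) (N u b : nat) (q p : {mpoly K[N]}) :
  q \is u.-homog ->
  pihomog mdeg b (q * p)
  = if (u <= b)%N then q * pihomog mdeg (b - u) p else 0.
Proof.
move=> hq; rewrite {1}(pihomog_partitionE (leq_maxl (mmeasure mdeg p) (b - u).+1)) mulr_sumr.
rewrite raddf_sum /=.
have h k : pihomog mdeg b (q * pihomog mdeg k p)
    = if (u + k == b)%N then q * pihomog mdeg k p else 0.
  have hk : q * pihomog mdeg k p \is (u + k)%N.-homog.
    by apply: dhomogM => //; apply: pihomogP.
  case: eqP => [e|/eqP ne]; first by rewrite pihomog_dE // -e.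
  by rewrite (pihomog_ne0 ne hk).
under eq_bigr => k _ do rewrite h.
case: ifP => ab; last first.
  rewrite big1 // => k _; case: eqP => // e.
  by rewrite -e leq_addr in ab.
have e (k : nat) : (u + k == b)%N = (k == b - u)%N.
  by rewrite -{1}(subnKC ab) eqn_add2l.
rewrite (bigD1 (Ordinal (leq_maxr _ (b - u).+1))) //= e eqxx big1 ?addr0 // => k kne.
by rewrite e ifN.
Qed.

Lemma graded_partM (K : fieldType) (N d d' e : nat) (q p : {mpoly K[N]}) :
  graded_entry d d' q -> graded_part d e (q * p) = q * graded_part d' e p.
Proof.
case=> [->|[dd' hq]].
  by rewrite !mul0r graded_part_id //; left.
rewrite /graded_part; case: (leqP d e) => de; last first.
  by rewrite leqNgt (leq_trans de dd') mulr0.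
rewrite (pihomogM _ _ hq) leq_sub2rE // subnBA // subnK //.
by case: ifP => // _; rewrite mulr0.
Qed.

Lemma mx_factor (A : nzRingType) (m p q : nat) (D : 'M[A]_(m, p))
    (Z : 'M[A]_(m, q)) :
  (forall t, exists w : 'cV_p, col t Z = D *m w) -> exists W, Z = D *m W.
Proof.
move=> h; have {}h t := cid (h t).
exists (\matrix_(s, t) sval (h t) s 0); apply/matrixP => s t.
have := congr1 (fun M : 'cV_m => M s 0) (svalP (h t)).
by rewrite /= !mxE => ->; apply: eq_bigr => u _; rewrite !mxE.
Qed.

(** A lift can be made homogeneous by keeping, in each of its entries, the
    component of the degree prescribed by the gradings: multiplication by a
    graded matrix commutes with this truncation. *)
Lemma graded_factor (K : fieldType) (N m p q : nat) (d : 'I_m -> nat)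
    (d' : 'I_p -> nat) (e : 'I_q -> nat) (D : 'M[{mpoly K[N]}]_(m, p))
    (Z : 'M[{mpoly K[N]}]_(m, q)) :
  graded_mx d d' D -> graded_mx d e Z -> (exists W, Z = D *m W) ->
  exists2 W, graded_mx d' e W & Z = D *m W.
Proof.
move=> gD gZ [W eZ].
exists (\matrix_(u, t) graded_part (d' u) (e t) (W u t)).
  by move=> u t; rewrite mxE; apply: graded_partP.
apply/matrixP => s t; rewrite -(graded_part_id (gZ s t)) eZ !mxE.
rewrite graded_part_sum; apply: eq_bigr => u _.
by rewrite mxE (graded_partM _ _ (gD s u)).
Qed.

Lemma mulmx0_col (A : nzRingType) (m p q : nat) (D : 'M[A]_(m, p))
    (D' : 'M[A]_(p, q)) :
  (forall w : 'cV_q, D *m (D' *m w) = 0) -> D *m D' = 0.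
Proof.
move=> h; apply/matrixP => s t.
have := congr1 (fun M : 'cV_m => M s 0) (h (delta_mx t 0)).
by rewrite /= mulmxA -colE !mxE.
Qed.

(** Exactness is tested on columns; assembling the columns lets one factor
    whole matrices, as the construction of lifts and homotopies requires. *)
Lemma exact_factor (A : nzRingType) (m p q : nat) (D : 'M[A]_(m, p))
    (D' : 'M[A]_(p, q)) :
  (forall v : 'cV_p, D *m v = 0 <-> exists w, v = D' *m w) ->
  D *m D' = 0 /\
  forall r (Z : 'M[A]_(p, r)), D *m Z = 0 -> exists W, Z = D' *m W.
Proof.
move=> h; split=> [|r Z hZ].
  by apply: mulmx0_col => w; apply/h; exists w.
by apply: mx_factor => t; apply/h; rewrite colE mulmxA hZ mul0mx.
Qed.

(** The comparison theorem: the lift is built position by position, the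
    invariant of the recursion being that the next square can be factored
    through the exact complex [F]. *)
Lemma lifts_mul_exists (K : fieldType) (N : nat) (g : {mpoly K[N]}) (dg : nat)
    (E F : complex K N) (J I : {mpoly K[N]} -> Prop) :
  g \is dg.-homog -> graded_free_resolution E J -> graded_free_resolution F I ->
  (forall p, J p -> I (g * p)) ->
  exists alpha, @lifts_mul K N g dg E F alpha.
Proof.
move=> hg [[gE0 gE] JE E0 E1] [[gF0 gF] IF F0 F1] JI.
have [cE0 _] := exact_factor E0.
have [_ fF0] := exact_factor F0.
pose degE i (s : 'I_(cx_rank E i)) := (cx_deg s + dg)%N.
pose Q i (A : 'M[{mpoly K[N]}]_(cx_rank F i, cx_rank E i)) :=
  graded_mx (@cx_deg K N F i) (@degE i) A /\
  exists W, A *m cx_diff E i = cx_diff F i *m W.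
have gEs i : graded_mx (@degE i) (@degE i.+1) (cx_diff E i).
  by move=> s t; apply: graded_entry_shift (gE i s t).
have step i (A : {A | Q i A}) :
    {B | Q i.+1 B /\ cx_diff F i *m B = sval A *m cx_diff E i}.
  case: A => A [gA hA]; apply: cid.
  have [B gB eB] := graded_factor (gF i) (graded_mx_mul gA (gEs i)) hA.
  exists B; split=> //; split=> //.
  have [_ fF] := exact_factor (F1 i); have [cE _] := exact_factor (E1 i).
  by apply: fF; rewrite mulmxA -eB -mulmxA cE mulmx0.
have [A0 QA0 eA0] : exists2 A, Q 0%N A & cx_aug F *m A = g *: cx_aug E.
  have gZ : graded_mx (fun=> 0%N) (@degE 0%N) (g *: cx_aug E).
    move=> s t; rewrite mxE mulrC.
    have h := graded_entry_shift dg (gE0 s t); rewrite add0n in h.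
    rewrite mulrC; apply: graded_entryM h.
    by right; rewrite leq0n subn0.
  have hZ : exists W, g *: cx_aug E = cx_aug F *m W.
    apply: mx_factor => t.
    have /JI/IF[v hv] : J (cx_aug E 0 t).
      apply/JE; exists (delta_mx t 0); rewrite -colE.
      by apply/matrixP => i j; rewrite !mxE !ord1 mulr1n.
    by exists v; rewrite hv; apply/matrixP => i j; rewrite !mxE !ord1 mulr1n.
  have [A gA eA] := graded_factor gF0 gZ hZ.
  exists A => //; split=> //; apply: fF0.
  by rewrite mulmxA -eA -scalemxAl cE0 scaler0.
pose seqA := nat_rect (fun i => {A | Q i A}) (exist _ A0 QA0)
  (fun i A => exist _ (sval (step i A)) (proj1 (svalP (step i A)))).
exists (fun i => sval (seqA i)); split=> [i||i].
- by have [] := svalP (seqA i).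
- exact: eA0.
- exact: (proj2 (svalP (step i (seqA i)))).
Qed.

Definition in_maximal (K : fieldType) (N m p : nat)
    (M : 'M[{mpoly K[N]}]_(m, p)) : Prop :=
  forall s t, (M s t)@_0%MM = 0.

Lemma mcoeff0M (K : fieldType) (N : nat) (p q : {mpoly K[N]}) :
  (p * q)@_0%MM = p@_0%MM * q@_0%MM.
Proof. exact: rmorphM. Qed.

Lemma in_maximal_mulr (K : fieldType) (N m p q : nat)
    (A : 'M[{mpoly K[N]}]_(m, p)) (B : 'M_(p, q)) :
  in_maximal B -> in_maximal (A *m B).
Proof.
move=> h s t; rewrite mxE raddf_sum big1 //= => u _.
by rewrite mcoeff0M h mulr0.
Qed.

Lemma in_maximal_mull (K : fieldType) (N m p q : nat)
    (A : 'M[{mpoly K[N]}]_(m, p)) (B : 'M_(p, q)) :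
  in_maximal A -> in_maximal (A *m B).
Proof.
move=> h s t; rewrite mxE raddf_sum big1 //= => u _.
by rewrite mcoeff0M h mul0r.
Qed.

(** Two lifts of the same multiplication are homotopic, and a homotopy only
    contributes entries that are combinations of those of the differentials.
    As [c beta] is a lift of the multiplication by [c h], all the lifts of the
    latter have their entries in the maximal ideal. *)
Lemma lift_in_maximal (K : fieldType) (N : nat) (c h : {mpoly K[N]}) (dg dh : nat)
    (E F : complex K N) (J I : {mpoly K[N]} -> Prop)
    (alpha beta : forall i, 'M[{mpoly K[N]}]_(cx_rank F i, cx_rank E i)) :
  c@_0%MM = 0 -> minimal_complex E -> minimal_complex F ->
  graded_free_resolution E J -> graded_free_resolution F I ->
  lifts_mul (c * h) dg alpha -> lifts_mul h dh beta ->
  forall i, in_maximal (alpha i).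
Proof.
move=> c0 mE mF [_ _ E0 E1] [_ _ F0 F1] [_ a0 a1] [_ b0 b1] i.
pose D i := alpha i - c *: beta i.
(* [H] is the homotopy into [F_(i+1)], and [U] what the previous stage of the
   homotopy contributes through the differential of [E]. *)
suff [H [U [eD mU _]]] : exists H U, [/\ D i = cx_diff F i *m H + U,
    in_maximal U & U *m cx_diff E i = 0].
  move=> s t; have -> : alpha i = cx_diff F i *m H + U + c *: beta i.
    by rewrite -eD subrK.
  rewrite !mxE !mcoeffD mcoeff0M c0 mul0r addr0 mU addr0.
  by have := in_maximal_mull H (mF i) s t; rewrite mxE.
have dD j : cx_diff F j *m D j.+1 = D j *m cx_diff E j.
  by rewrite mulmxBr mulmxBl a1 -scalemxAr b1 scalemxAl.
elim: i => [|i [H [U [eD mU cU]]]].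
  have [_ fF] := exact_factor F0.
  have [|H eH] := fF _ (D 0%N).
    by rewrite mulmxBr a0 -scalemxAr b0 scalerA subrr.
  exists H, 0; rewrite addr0 mul0mx; split=> // s t.
  by rewrite mxE mcoeff0.
have [_ fF] := exact_factor (F1 i); have [cE _] := exact_factor (E1 i).
have [|H' eH'] := fF _ (D i.+1 - H *m cx_diff E i).
  by rewrite mulmxBr dD eD mulmxDl cU addr0 mulmxA subrr.
exists H', (H *m cx_diff E i); split; first by rewrite -eH' subrK.
  by apply: in_maximal_mulr => s t; apply: mE.
by rewrite -mulmxA cE mulmx0.
Qed.

Lemma cone_exact (A : nzRingType) (m p p' q q' q'' : nat)
    (d : 'M[A]_(m, p)) (d' : 'M[A]_(p, p')) (b : 'M[A]_(q, q'))
    (b' : 'M[A]_(q', q'')) (a : 'M[A]_(q, p)) (a' : 'M[A]_(q', p')) :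
  b *m a' = a *m d' ->
  (forall v : 'cV_p, d *m v = 0 <-> exists w, v = d' *m w) ->
  (forall v : 'cV_q', b *m v = 0 <-> exists w, v = b' *m w) ->
  forall v : 'cV_(p + q'), block_mx (- d) 0 a b *m v = 0 <->
    exists w, v = block_mx (- d') 0 a' b' *m w.
Proof.
move=> ba hd hb v; have [dd' _] := exact_factor hd.
have [bb' _] := exact_factor hb; split=> [|[w ->]]; last first.
  rewrite mulmxA mulmx_block !(mulmx0, mul0mx, addr0, add0r) mulNmx mulmxN.
  by rewrite opprK dd' mulmxN ba addNr bb' block_mx0 mul0mx.
rewrite -[v]vsubmxK mul_block_col mul0mx addr0 -col_mx0 => /eq_col_mx[].
rewrite mulNmx => /eqP; rewrite oppr_eq0 => /eqP/hd[u eu] hv.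
have /hb[w ew] : b *m (a' *m u + dsubmx v) = 0.
  by rewrite mulmxDr mulmxA ba -mulmxA -eu hv.
exists (col_mx (- u) w); rewrite mul_block_col mul0mx addr0 mulNmx mulmxN opprK.
by rewrite -eu -ew mulmxN addKr.
Qed.

(** The colon condition enters at the augmentation only: a relation
    [g x + (element of I) = 0] forces [x] into the ideal resolved by [E]. *)
Lemma mapping_cone_resolution (K : fieldType) (N : nat) (g : {mpoly K[N]})
    (dg : nat) (E F : complex K N) (J I : {mpoly K[N]} -> Prop)
    (alpha : forall i, 'M[{mpoly K[N]}]_(cx_rank F i, cx_rank E i)) :
  g \is dg.-homog -> graded_free_resolution E J -> graded_free_resolution F I ->
  lifts_mul g dg alpha -> (forall p, I (g * p) -> J p) ->
  graded_free_resolution (mapping_cone g dg alpha)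
    (fun p => exists c q, I q /\ p = c * g + q).
Proof.
move=> hg [[gE0 gE] JE E0 E1] [[gF0 gF] IF F0 F1] [ga a0 a1] IJ.
split.
- split=> [s t|[|i] s t] /=.
  + case: (split_ordP t) => t' ->; rewrite ?row_mxEl ?row_mxEr.
      rewrite mxE !ord1 mulr1n -/(graded_entry _ _ _).
      by right; rewrite leq0n subn0.
    exact: gF0.
  + case: (split_ordP s) => s' ->; case: (split_ordP t) => t' ->;
      rewrite ?block_mxEul ?block_mxEur ?block_mxEdl ?block_mxEdr
        -/(graded_entry _ _ _).
    * rewrite mxE; apply: graded_entryN; rewrite ord1 -[dg]add0n.
      exact: graded_entry_shift (gE0 0 t').
    * by rewrite mxE; left.
    * exact: ga.
    * exact: gF.
  + case: (split_ordP s) => s' ->; case: (split_ordP t) => t' ->;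
      rewrite ?block_mxEul ?block_mxEur ?block_mxEdl ?block_mxEdr
        -/(graded_entry _ _ _).
    * rewrite mxE; apply: graded_entryN.
      exact: graded_entry_shift (gE i s' t').
    * by rewrite mxE; left.
    * exact: ga.
    * exact: gF.
- move=> p /=; split=> [[c [q [/IF[v hv] ->]]]|[v]].
    exists (col_mx c%:M v); rewrite mul_row_col hv -scalar_mxM mulrC.
    by rewrite -raddfD.
  rewrite -[v]vsubmxK mul_row_col mul_scalar_mx => hv.
  exists (usubmx v 0 0), (p - usubmx v 0 0 * g); split; last by rewrite addrC subrK.
  apply/IF; exists (dsubmx v); apply/matrixP => i j; rewrite !ord1.
  have := congr1 (fun M : 'M_1 => M 0 0) hv; rewrite /= [in X in X -> _]mxE.
  rewrite [X in X + _ = _]mxE ![_%:M _ _]mxE !mulr1n => <-.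
  by rewrite mulrC addrC addKr.
- move=> v /=; have [cE0 _] := exact_factor E0; have [cF0 _] := exact_factor F0.
  split=> [|[w ->]]; last first.
    rewrite mulmxA mul_row_block mul_scalar_mx mulmx0 add0r scalerN a0 addNr.
    by rewrite cF0 row_mx0 mul0mx.
  rewrite -[v]vsubmxK mul_row_col mul_scalar_mx => hv.
  have /IJ/JE[u hu] : I (g * usubmx v 0 0).
    apply/IF; exists (- dsubmx v); rewrite mulmxN.
    have -> : cx_aug F *m dsubmx v = - (g *: usubmx v).
      by apply/eqP; rewrite -addr_eq0 addrC hv.
    by apply/matrixP => i j; rewrite opprK !mxE !ord1 mulr1n.
  have eu : usubmx v = cx_aug E *m u.
    by rewrite hu; apply/matrixP => i j; rewrite !mxE !ord1 mulr1n.
  have /F0[w ew] : cx_aug F *m (alpha 0%N *m u + dsubmx v) = 0.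
    by rewrite mulmxDr mulmxA a0 -scalemxAl -eu hv.
  exists (col_mx (- u) w); rewrite mul_block_col mul0mx addr0 mulNmx mulmxN opprK.
  by rewrite -eu -ew mulmxN addKr.
- case=> [|i] /=; exact: cone_exact.
Qed.

Lemma mapping_cone_minimal (K : fieldType) (N : nat) (g : {mpoly K[N]})
    (dg : nat) (E F : complex K N)
    (alpha : forall i, 'M[{mpoly K[N]}]_(cx_rank F i, cx_rank E i)) :
  in_maximal (cx_aug E) -> minimal_complex E -> minimal_complex F ->
  (forall i, in_maximal (alpha i)) ->
  minimal_complex (mapping_cone g dg alpha).
Proof.
move=> mE0 mE mF ma [|i] s t /=;
  case: (split_ordP s) => s' ->; case: (split_ordP t) => t' ->;
  rewrite ?block_mxEul ?block_mxEur ?block_mxEdl ?block_mxEdr.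
- by rewrite mxE mcoeffN mE0 oppr0.
- by rewrite mxE mcoeff0.
- exact: ma.
- exact: mF.
- by rewrite mxE mcoeffN mE oppr0.
- by rewrite mxE mcoeff0.
- exact: ma.
- exact: mF.
Qed.

(** * The iterated mapping cone *)

(** The order in which the pairs are added. *)
Definition pair_before (n : nat) (u v : 'I_n * 'I_n) : bool :=
  (v.1 < u.1)%N || ((v.1 == u.1) && (v.2 < u.2)%N).

Lemma pair_before_irr (n : nat) (u : 'I_n * 'I_n) : pair_before u u = false.
Proof. by rewrite /pair_before !ltnn andbF. Qed.

Lemma pair_before_asym (n : nat) (u v : 'I_n * 'I_n) :
  pair_before u v -> pair_before v u = false.
Proof.
rewrite /pair_before => /orP[h|/andP[/eqP -> h]].
  by rewrite ltnNge (ltnW h) /=; case: eqP h => // ->; rewrite ltnn.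
by rewrite ltnn eqxx /= ltnNge (ltnW h).
Qed.

Lemma mem_cone_order (n : nat) (u : 'I_n * 'I_n) :
  (u \in cone_order n) = (u.1 < u.2)%N.
Proof.
apply/allpairsPdep/idP => [[k [j []]]|h].
  by rewrite mem_filter => _ /andP[kj _] ->.
exists u.1, u.2; rewrite mem_filter !mem_rev !mem_enum h /=.
by split=> //; case: u {h}.
Qed.

Lemma cone_order_pairwise (n : nat) : pairwise (@pair_before n) (cone_order n).
Proof.
have dec : pairwise (fun i j : 'I_n => (j < i)%N) (rev (enum 'I_n)).
  rewrite -sorted_pairwise; last by move=> j i k ji kj; apply: ltn_trans kj ji.
  rewrite rev_sorted.
  have := iota_ltn_sorted 0 n; rewrite -val_enum_ord sorted_map.
  by [].
suff H s : pairwise (fun i j : 'I_n => (j < i)%N) s ->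
    pairwise (@pair_before n)
      [seq (k, j) | k : 'I_n <- s,
                    j : 'I_n <- [seq j : 'I_n <- rev (enum 'I_n) | (k < j)%N]].
  exact: H.
elim: s => //= k s IH /andP[/allP ks ds].
rewrite pairwise_cat IH // andbT; apply/andP; split.
  apply/allrelP => u v /mapP[j _ ->] /allpairsPdep[k' [j' [k's _ ->]]].
  by rewrite /pair_before /= ks.
rewrite pairwise_map; apply: sub_pairwise (pairwise_filter _ dec) => i j /= ji.
by rewrite /pair_before /= eqxx ji orbT.
Qed.

Lemma cone_order_uniq (n : nat) : uniq (cone_order n).
Proof. exact: pairwise_uniq (@pair_before_irr n) (cone_order_pairwise n). Qed.

(** When [f_k f_j] is added, the generators already present are those of the
    ideal [I'] of the construction: the [f_k f_c] with [c > j] and the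
    [f_a f_b] with [k < a < b]. *)
Lemma cone_order_prefix (n : nat) (s t : seq ('I_n * 'I_n)) (k j : 'I_n) :
  cone_order n = rcons s (k, j) ++ t ->
  (k < j)%N /\ forall u, (u \in s)
     = (u.1 < u.2)%N && ((k < u.1)%N || ((k == u.1) && (j < u.2)%N)).
Proof.
move=> e; have mem (u : 'I_n * 'I_n) := mem_cone_order u.
have := cone_order_pairwise n; rewrite e pairwise_cat pairwise_rcons.
case/and3P=> /allrelP hst /andP[/allP hs _] _.
split=> [|u]; first by rewrite -[(_ < _)%N](mem (k, j)) e mem_cat mem_rcons mem_head.
apply/idP/andP => [us|[u12 ub]].
  split; last by have := hs _ us; rewrite /pair_before /=.
  by rewrite -mem e mem_cat mem_rcons inE us orbT.
have : u \in cone_order n by rewrite mem.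
rewrite e mem_cat mem_rcons inE => /orP[/orP[/eqP eu|//]|ut].
  by move: ub; rewrite eu /= !ltnn andbF.
have := hst (k, j) u; rewrite mem_rcons mem_head ut => /(_ isT isT).
by move/pair_before_asym; rewrite {1}/pair_before /= ub.
Qed.

(** All the generators present when [f_k f_j] is added lie in the ideal
    [(f_b : b > k, b != j)], modulo which [f_k] and [f_j] are regular. *)
Lemma pair_ideal_colon (A : comNzRingType) (n : nat) (f : 'I_n -> A)
    (s t : seq ('I_n * 'I_n)) (k j : 'I_n) p :
  regular_family f -> cone_order n = rcons s (k, j) ++ t ->
  in_span (pair_prod f) [set u in s] (f k * f j * p) ->
  in_span f [set b : 'I_n | (k < b)%N && (b != j)] p.
Proof.
move=> rf /cone_order_prefix[kj mem] h.
have : in_span f [set b : 'I_n | (k < b)%N && (b != j)] (f k * f j * p).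
  apply: in_span_sub h => u; rewrite inE mem => /andP[u12 /orP[ku|/andP[/eqP ku ju]]].
    have [e1|n1] := eqVneq u.1 j.
      apply/in_spanM/in_span_gen; rewrite inE (ltn_trans ku u12) /=.
      by apply: contraTneq u12 => ->; rewrite e1 ltnn.
    rewrite /pair_prod mulrC; apply/in_spanM/in_span_gen.
    by rewrite inE ku n1.
  apply/in_spanM/in_span_gen; rewrite inE (ltn_trans kj ju) /=.
  by apply: contraTneq ju => ->; rewrite ltnn.
rewrite -mulrA => /rf; rewrite !inE ltnn => /(_ isT) /rf.
by rewrite !inE eqxx andbF => /(_ isT).
Qed.

(** The factor [f j] alone already carries the colon ideal into the ideal of
    the previous generators; hence multiplication by [f k * f j] is [f k] times
    a lift of multiplication by [f j]. *)
Lemma pair_ideal_mul (A : comNzRingType) (n : nat) (f : 'I_n -> A)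
    (s t : seq ('I_n * 'I_n)) (k j : 'I_n) p :
  cone_order n = rcons s (k, j) ++ t ->
  in_span f [set b : 'I_n | (k < b)%N && (b != j)] p ->
  in_span (pair_prod f) [set u in s] (f j * p).
Proof.
move=> /cone_order_prefix[kj mem] [c ->]; rewrite mulr_sumr.
apply: in_span_sum => b; rewrite inE => /andP[kb bj].
rewrite mulrCA; apply: in_spanM.
have [lt|gt|/val_inj e] := ltngtP b j; last by rewrite e eqxx in bj.
  rewrite mulrC; apply: (@in_span_gen _ _ (pair_prod f) _ (b, j)).
  by rewrite inE mem /= lt kb.
apply: (@in_span_gen _ _ (pair_prod f) _ (j, b)).
by rewrite inE mem /= gt kj.
Qed.

Lemma in_span_rcons (A : comNzRingType) (J : finType) (g : J -> A) (s : seq J) x p :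
  in_span g [set u in rcons s x] p <->
  exists c q, in_span g [set u in s] q /\ p = c * g x + q.
Proof.
have sub q : in_span g [set u in s] q -> in_span g [set u in rcons s x] q.
  apply: in_span_sub => u; rewrite inE => us.
  by apply: in_span_gen; rewrite inE mem_rcons inE us orbT.
have xs : x \in [set u in rcons s x] by rewrite inE mem_rcons mem_head.
split=> [/(in_spanD1 _ _ xs)[c hc]|[c [q [hq ->]]]]; last first.
  by apply: in_spanD; [apply/in_spanM/in_span_gen | apply: sub].
exists c, (p - c * g x); split; last by rewrite addrC subrK.
apply: in_span_sub hc => u; rewrite !inE mem_rcons inE => /andP[/negPf -> us].
by apply: in_span_gen; rewrite inE.
Qed.

Lemma graded_free_resolution_iff (K : fieldType) (N : nat) (C : complex K N)
    (I I' : {mpoly K[N]} -> Prop) :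
  (forall p, I p <-> I' p) -> graded_free_resolution C I ->
  graded_free_resolution C I'.
Proof. by move=> h [g hI h0 h1]; split=> // p; rewrite -h hI. Qed.

Lemma principal_resolutionP (K : fieldType) (N : nat) (g : {mpoly K[N]}) (dg : nat) :
  g != 0 -> g \is dg.-homog ->
  graded_free_resolution (principal_resolution g dg) (fun p => exists c, p = c * g).
Proof.
move=> g0 hg; split.
- split=> [s t|i s t]; last by left; rewrite mxE.
  rewrite !ord1 /= mxE mulr1n; right; by rewrite subn0.
- move=> p; split=> [[c ->]|[v]] /=.
    by exists c%:M; rewrite -scalar_mxM mulrC.
  rewrite mul_scalar_mx => hv; exists (v 0 0).
  by have := congr1 (fun M : 'M_1 => M 0 0) hv; rewrite /= !mxE mulr1n mulrC.
- move=> v /=; split=> [|[w ->]]; last by rewrite mul0mx mulmx0.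
  rewrite mul_scalar_mx => hv; exists 0; rewrite mul0mx; apply/matrixP => i j.
  have := congr1 (fun M : 'M_1 => M i j) hv; rewrite /= !mxE => /eqP.
  by rewrite mulf_eq0 (negPf g0) => /eqP.
- move=> i v /=; split=> _; last by rewrite mul0mx.
  by exists 0; apply/matrixP => -[].
Qed.

Lemma dhomog_mcoeff0 (K : fieldType) (N d : nat) (p : {mpoly K[N]}) :
  (0 < d)%N -> p \is d.-homog -> p@_0%MM = 0.
Proof. by move=> d0 hp; rewrite (dhomog_nemf_coeff hp) //= mdeg0; case: d d0 {hp}. Qed.

Lemma koszul_coef_in_maximal (K : fieldType) (N n : nat)
    (f : 'I_n -> {mpoly K[N]}) (S S' : {set 'I_n}) :
  (forall b, (f b)@_0%MM = 0) -> (koszul_coef f S S')@_0%MM = 0.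
Proof.
by move=> h; rewrite raddf_sum big1 //= => b _; rewrite mcoeff0M h mulr0.
Qed.

Lemma split_lshift m n (i : 'I_m) : split (lshift n i) = inl i.
Proof. exact: (unsplitK (inl i)). Qed.

Lemma split_rshift m n (i : 'I_n) : split (rshift m i) = inr i.
Proof. exact: (unsplitK (inr i)). Qed.

(** The stage [u = (k, j)] adds in position [h] one generator for each subset
    [S] of size [h] of [{b > k, b != j}]: the new one of degree [l_k + l_j] when
    [S] is empty, and the shifted Koszul generators otherwise. *)
Definition stage_weight (n : nat) (l : 'I_n -> nat) (phi : nat -> nat) (h : nat)
    (u : 'I_n * 'I_n) : nat :=
  (\sum_(S : {set 'I_n} | (S \subset [set b : 'I_n | (u.1 < b) && (b != u.2)])
        && (#|S| == h)) phi (\sum_(b in S) l b + (l u.1 + l u.2)))%N.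

(** The weights [phi] stand for the indicator functions of the degrees and for
    the constant 1, which gives the ranks. *)
Lemma cone_run_invariant (K : fieldType) (N n : nat) (l : 'I_n -> nat)
    (f : 'I_n -> {mpoly K[N]}) (s : seq ('I_n * 'I_n)) (C : complex K N) :
  (forall b, f b \is (l b).-homog) -> (forall b, (0 < l b)%N) ->
  regular_family f -> mapping_cone_run l f s C ->
  forall t, cone_order n = s ++ t ->
  [/\ graded_free_resolution C (in_span (pair_prod f) [set u in s]),
      minimal_complex C
    & forall phi h, (\sum_(i < cx_rank C h) phi (cx_deg i)
        = \sum_(u <- s) stage_weight l phi h u)%N].
Proof.
move=> hf l0 rf; have f0 b := dhomog_mcoeff0 (l0 b) (hf b).
have fn0 b : f b != 0.
  apply/eqP => fb0; have := rf set0 b; rewrite inE => /(_ isT 1).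
  rewrite fb0 mul0r => /(_ (in_span0 _ _))/in_span_set0/eqP.
  by rewrite oner_eq0.
have hff k j : f k * f j \is (l k + l j)%N.-homog by apply: dhomogM.
elim=> {s C} [k j|s k j F E alpha run IH la] t et.
  have [kj mem] := @cone_order_prefix n [::] t k j et.
  split.
  - apply: (@graded_free_resolution_iff _ _ _ (fun p => exists c, p = c * (f k * f j))).
      move=> p; rewrite -[[:: _]]/(rcons [::] (k, j)) in_span_rcons.
      split=> [[c ->]|[c [q [hq ->]]]].
        by exists c, 0; rewrite addr0; split=> //; apply: in_span0.
      exists c; rewrite [q](_ : _ = 0) ?addr0 //; case: hq => d ->.
      by rewrite big1 // => u; rewrite inE.
    by apply: principal_resolutionP; rewrite ?mulf_neq0.
  - by move=> i a b; rewrite mxE mcoeff0.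
  - move=> phi h; rewrite big_seq1 /stage_weight /=.
    have -> : [set b : 'I_n | (k < b)%N && (b != j)] = set0.
      apply/setP => b; rewrite !inE; apply/negP => /andP[kb bj].
      (* [(b, j)] or [(k, b)] would have been added earlier. *)
      have [lt|gt|/val_inj e] := ltngtP b j; last by rewrite e eqxx in bj.
        by have := mem (b, j); rewrite /= lt kb.
      by have := mem (k, b); rewrite /= kb gt eqxx orbT.
    case: h => [|h] /=.
      rewrite big_ord1 (big_pred1 set0) ?big_set0 // => S.
      by rewrite subset0 cards_eq0 andbb.
    rewrite big_ord0 big_pred0 // => S; rewrite subset0.
    by case: eqP => // ->; rewrite cards0.
have ext : cone_order n = s ++ (k, j) :: t by rewrite et cat_rcons.
have [rF mF wF] := IH _ ext.
have rE := koszul_resolution [set b : 'I_n | (k < b)%N && (b != j)] hf rf.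
have colon p := @pair_ideal_colon _ _ f s t k j p rf et.
split.
- apply: graded_free_resolution_iff (mapping_cone_resolution (hff k j) rE rF la colon).
  by move=> p; rewrite in_span_rcons.
- have [|beta lb] := lifts_mul_exists (hf j) rE rF.
    by move=> p; apply: pair_ideal_mul et.
  have mE : minimal_complex E.
    by move=> i a b; rewrite mxE koszul_coef_in_maximal.
  apply: mapping_cone_minimal => //.
    by move=> a b; rewrite mxE koszul_coef_in_maximal.
  exact: lift_in_maximal (f0 k) mE mF rE rF la lb.
- move=> phi h; rewrite -cats1 big_cat big_seq1 /= -wF [RHS]addnC.
  case: h => [|h] /=.
    rewrite big_split_ord big_ord1 /=; congr (_ + _)%N.
      rewrite split_lshift /stage_weight /= (big_pred1 set0) ?big_set0 // => S.
      by rewrite cards_eq0 /=; case: eqP => [->|_]; rewrite ?sub0set ?andbF.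
    by apply: eq_bigr => i _; rewrite split_rshift.
  rewrite big_split_ord /=; congr (_ + _)%N.
    under eq_bigr => i _ do rewrite split_lshift.
    rewrite -(big_enum_val (fun S : {set 'I_n} =>
      phi (\sum_(b in S) l b + (l k + l j))%N)) /=.
    by apply: eq_bigl => S; rewrite inE.
  by apply: eq_bigr => i _; rewrite split_rshift.
Qed.

Lemma cone_run_exists (K : fieldType) (N n : nat) (l : 'I_n -> nat)
    (f : 'I_n -> {mpoly K[N]}) :
  (1 < n)%N -> (forall b, f b \is (l b).-homog) -> (forall b, (0 < l b)%N) ->
  regular_family f -> exists C : complex K N, iterated_mapping_cone l f C.
Proof.
move=> n1 hf l0 rf.
suff H s t : s != [::] -> cone_order n = s ++ t ->
    exists C, mapping_cone_run l f s C.
  apply: (H _ [::]); last by rewrite cats0.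
  apply/eqP => e.
  have := mem_cone_order (Ordinal (ltnW n1), Ordinal n1).
  by rewrite e.
elim/last_ind: s t => // s [k j] IH t _ et.
have [s0|s0] := eqVneq s [::].
  by rewrite s0; eexists; apply: Run_start.
have ext : cone_order n = s ++ (k, j) :: t by rewrite et cat_rcons.
have [F run] := IH _ s0 ext.
have [rF _ _] := cone_run_invariant hf l0 rf run ext.
have rE := koszul_resolution [set b : 'I_n | (k < b)%N && (b != j)] hf rf.
have hff : f k * f j \is (l k + l j)%N.-homog by apply: dhomogM.
have [|alpha la] := lifts_mul_exists hff rE rF.
  by move=> p hp; rewrite -mulrA; apply/in_spanM/(pair_ideal_mul et).
by eexists; apply: Run_step run la.
Qed.

(** A set [B] of size [h + 2] is split as [{k, j}] and the rest with [k] its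
    least element, and [j] is then any of the [h + 1] others. *)
Lemma stage_weight_sum (n : nat) (l : 'I_n -> nat) (phi : nat -> nat) (h : nat) :
  (\sum_(u <- cone_order n) stage_weight l phi h u
   = \sum_(B : {set 'I_n} | #|B| == h.+2) h.+1 * phi (\sum_(b in B) l b))%N.
Proof.
rewrite (eq_bigl (fun u => xpredT u)) // (big_uniq _ (cone_order_uniq n)) /=.
pose good (B : {set 'I_n}) (u : 'I_n * 'I_n) :=
  [&& u.1 \in B, u.2 \in B, (u.1 < u.2)%N & [forall b in B, (u.1 <= b)%N]].
transitivity (\sum_(u : 'I_n * 'I_n | (u.1 < u.2)%N)
    \sum_(B : {set 'I_n} | (#|B| == h.+2) && good B u) phi (\sum_(b in B) l b))%N.
  apply: eq_big => [u|[k j]]; first by rewrite mem_cone_order.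
  rewrite mem_cone_order /= => kj; rewrite /stage_weight /=.
  have kj' : k != j by apply: contraTneq kj => ->; rewrite ltnn.
  rewrite [RHS](reindex_onto (fun S => k |: (j |: S)) (fun B => B :\ k :\ j)) /=.
    apply: eq_big => [S|S /andP[/subsetP ST _]]; last first.
      have kS : k \notin j |: S.
        rewrite !inE (negPf kj') /=; apply/negP => /ST.
        by rewrite inE ltnn.
      have jS : j \notin S by apply/negP => /ST; rewrite inE eqxx andbF.
      by rewrite !big_setU1 //= [in RHS]addnA addnC.
    apply/andP/andP => [[/subsetP ST /eqP cS]|[/andP[cB gB] /eqP eS]].
      have kS : k \notin j |: S.
        rewrite !inE (negPf kj') /=; apply/negP => /ST.
        by rewrite inE ltnn.
      have jS : j \notin S by apply/negP => /ST; rewrite inE eqxx andbF.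
      rewrite !cardsU1 kS jS cS !setU1K // !eqxx; split=> //.
      rewrite /good /= !inE !eqxx orbT kj /=; apply/forall_inP => b.
      rewrite !inE => /or3P[/eqP -> //|/eqP ->|/ST]; first exact: ltnW.
      by rewrite inE => /andP[/ltnW].
    have jS : j \notin S by rewrite -eS !inE eqxx.
    have kS : k \notin S by rewrite -eS !inE eqxx andbF.
    split; last by move: cB; rewrite !cardsU1 !inE negb_or kj' kS jS.
    case/and4P: gB => _ _ _ /forall_inP hB.
    apply/subsetP => b bS; rewrite inE ltn_neqAle hB ?inE ?bS ?orbT // andbT.
    by apply/andP; split; [apply: contraNneq kS => /val_inj -> | apply: contraNneq jS => <-].
  move=> B /andP[_ /and4P[kB jB _ _]].
  rewrite [j |: _]setD1K ?setD1K // !inE jB andbT eq_sym.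
  exact: kj'.
rewrite (exchange_big_dep (fun B : {set 'I_n} => #|B| == h.+2)) /=; last first.
  by move=> u B _ /andP[].
apply: eq_bigr => B cB; rewrite sum_nat_const; congr (_ * _)%N.
have [i0 i0B] : exists i, i \in B by apply/card_gt0P; rewrite (eqP cB).
have [m mB mmin] : exists2 m : 'I_n, m \in B & forall j : 'I_n, j \in B -> (m <= j)%N.
  by case: (@arg_minnP _ i0 (mem B) (@nat_of_ord n)) => // m mB hm; exists m.
have cBm : #|B :\ m| = h.+1.
  by move: cB; rewrite (cardsD1 m) mB => /eqP[].
rewrite -[RHS]cBm -[RHS](card_imset _ (f := pair m)) => [|j j' [] //].
apply: eq_card => -[k j]; rewrite [LHS]inE /= cB /good /=.
apply/idP/imsetP => [/and4P[kj kB jB /andP[_ /forall_inP kmin]]|[j' j'B [-> ->]]].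
  have ek : k = m by apply/val_inj/anti_leq; rewrite /= kmin //= mmin.
  exists j; rewrite -?ek // !inE jB andbT.
  by apply: contraTneq kj => ->; rewrite ltnn.
case/setD1P: j'B => j'm j'B; rewrite mB j'B ltn_neqAle mmin // andbT eq_sym.
rewrite -val_eqE in j'm; rewrite j'm /=.
by apply/forall_inP => b; apply: mmin.
Qed.

Lemma iterated_mapping_cone_resolution (K : fieldType) (N n : nat)
    (l : 'I_n -> nat) (f : 'I_n -> {mpoly K[N]}) (C : complex K N) :
  (forall b, f b \is (l b).-homog) -> (forall b, (0 < l b)%N) ->
  regular_family f -> iterated_mapping_cone l f C ->
  [/\ minimal_graded_free_resolution C
         (in_span (pair_prod f) [set u : 'I_n * 'I_n | (u.1 < u.2)%N]),
      forall h, perm_eq [seq cx_deg s | s : 'I_(cx_rank C h)] (expected_degrees l h)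
    & forall h, (n - 2 < h)%N -> cx_rank C h = 0%N].
Proof.
move=> hf l0 rf run.
have [|rC mC wC] := cone_run_invariant hf l0 rf run (t := [::]); first by rewrite cats0.
have w phi h : (\sum_(i < cx_rank C h) phi (cx_deg i)
    = \sum_(B : {set 'I_n} | #|B| == h.+2) h.+1 * phi (\sum_(b in B) l b))%N.
  by rewrite wC stage_weight_sum.
split=> [|h|h nh].
- split=> //; apply: graded_free_resolution_iff rC => p.
  suff -> : [set u in cone_order n] = [set u : 'I_n * 'I_n | (u.1 < u.2)%N] by [].
  by apply/setP => u; rewrite !inE mem_cone_order.
- apply/permP => P; rewrite /expected_degrees count_flatten -map_comp sumnE big_map.
  rewrite -sum1_count [LHS]big_map big_enum_cond /= big_mkcond /=.
   rewrite (w (fun d => if P d then 1 else 0)%N) [RHS]big_enum /=.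
  apply: eq_big => [B|B _]; first by rewrite inE.
  by rewrite count_nseq -mulnS mulnC; case: (P _).
- have := w (fun=> 1%N) h; rewrite sum_nat_const card_ord muln1 => ->.
  rewrite big_pred0 // => B; apply/negP => /eqP cB.
  have := leq_sub2r 2 (max_card B).
  by rewrite card_ord cB !subSS subn0 leqNgt nh.
Qed.

(** * The ideals of grids and pseudo-grids *)

Lemma ideal_gen_in_span (A : comNzRingType) (J : finType) (g : J -> A)
    (T : {set J}) (G : A -> Prop) p :
  (forall q, G q -> in_span g T q) -> (forall b, b \in T -> G (g b)) ->
  ideal_gen G p <-> in_span g T p.
Proof.
move=> Gg gG; split=> [[s [hs ->]]|[c ->]].
  by rewrite big_seq; apply: in_span_sum => u /hs/Gg; apply: in_spanM.
exists [seq (c b, g b) | b <- enum T]; split=> [u|].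
  by case/mapP => b; rewrite mem_enum => /gG hb ->.
by rewrite big_map big_enum.
Qed.

Definition row_entries (K : fieldType) (n r : nat) (l : 'I_n -> nat)
    (L : 'M[linear_form K n]_(n, r)) (j : 'I_n) : seq {mpoly K[n.+1]} :=
  [seq mpoly_of_dhomog (L j i) | i : 'I_r <- enum 'I_r & (i < l j)%N].

Lemma grid_form_prods (K : fieldType) (n r : nat) (l : 'I_n -> nat)
    (L : 'M[linear_form K n]_(n, r)) :
  grid_form l L = prods (row_entries l L).
Proof.
by apply/funext => j; rewrite /grid_form /prods big_map big_filter big_enum_cond.
Qed.

Lemma row_entriesP (K : fieldType) (n r : nat) (l : 'I_n -> nat)
    (L : 'M[linear_form K n]_(n, r)) j x :
  reflect (exists2 i : 'I_r, (i < l j)%N & x = mpoly_of_dhomog (L j i))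
    (x \in row_entries l L j).
Proof.
apply: (iffP mapP) => [[i]|[i il ->]].
  by rewrite mem_filter => /andP[il _] ->; exists i.
by exists i; rewrite // mem_filter il mem_enum.
Qed.

Lemma row_entries_neq0 (K : fieldType) (n r : nat) (l : 'I_n -> nat)
    (L : 'M[linear_form K n]_(n, r)) j :
  (0 < l j)%N -> (l j <= r)%N -> row_entries l L j != [::].
Proof.
move=> l0 lr; have r0 := leq_trans l0 lr.
have : mpoly_of_dhomog (L j (Ordinal r0)) \in row_entries l L j.
  by apply/row_entriesP; exists (Ordinal r0).
by case: row_entries.
Qed.

Lemma grid_form_homog (K : fieldType) (n r : nat) (l : 'I_n -> nat)
    (L : 'M[linear_form K n]_(n, r)) j :
  (l j <= r)%N -> grid_form l L j \is (l j).-homog.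
Proof.
move=> lr.
have -> : l j = (\sum_(i < r | (i < l j)%N) 1)%N.
  by rewrite -(big_ord_widen r (fun=> 1%N) lr) sum1_card card_ord.
rewrite /grid_form; elim/big_rec2: _ => [|i d p _ hp]; first exact: dhomog1.
by apply: dhomogM => //; apply: dhomog_is_dhomog.
Qed.

Lemma pseudo_regular (K : fieldType) (n r : nat) (l : 'I_n -> nat)
    (L : 'M[linear_form K n]_(n, r)) :
  (forall j, 0 < l j)%N -> (forall j, l j <= r)%N -> pseudo_lifting_matrix L ->
  regular_family (grid_form l L).
Proof.
move=> l0 lr [dimL _]; rewrite grid_form_prods.
apply: regular_family_prods => [j|c hc]; first exact: row_entries_neq0.
have {}hc j : {i : 'I_r | c j = mpoly_of_dhomog (L j i)}.
  by apply: cid; have /row_entriesP[i _ ->] := hc j; exists i.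
pose i : {ffun 'I_n -> 'I_r} := [ffun j => sval (hc j)].
have -> : c = fun j => mpoly_of_dhomog (L j (i j)).
  by apply/funext => j; rewrite ffunE -(svalP (hc j)).
apply: (@regular_family_linear _ _ _ (fun j => L j (i j))).
apply: free_family; rewrite /free dimL.
by rewrite size_map -cardE card_ord.
Qed.

Lemma in_span_pairs_lt (A : comNzRingType) (n : nat) (f : 'I_n -> A) p :
  in_span (pair_prod f) [set u : 'I_n * 'I_n | u.1 != u.2] p ->
  in_span (pair_prod f) [set u : 'I_n * 'I_n | (u.1 < u.2)%N] p.
Proof.
apply: in_span_sub => -[a b]; rewrite inE /= => ab.
have [lt|gt|/val_inj e] := ltngtP a b; last by rewrite e eqxx in ab.
  by apply: in_span_gen; rewrite inE.
rewrite /pair_prod mulrC.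
by apply: (@in_span_gen _ _ (pair_prod f) _ (b, a)); rewrite inE.
Qed.

Lemma Omega_monomial (K : fieldType) (n : nat) (l : 'I_n -> nat)
    (m : 'X_{1..n}) :
  @Omega K n l 'X_[m] <-> forall k, exists2 j, j != k & (l j <= m j)%N.
Proof.
split=> h k; have := h k; last first.
  case=> j jk lm; exists [:: ('X_[m - U_(j) *+ l j], 'X_j ^+ l j)].
  split=> [u|]; first by rewrite inE => /eqP -> /=; exists j.
  rewrite big_seq1 /= mpolyXn -mpolyXD submK //.
  apply/mnm_lepP => i; rewrite mulmnE mnm1E.
  by case: eqP => [<-|]; rewrite ?mul1n.
case=> s [hs /(congr1 (mcoeff m))]; rewrite mcoeffX eqxx raddf_sum /=.
apply: contraPP => hm; rewrite big_seq big1 ?oner_eq0 //; last first.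
  move=> u us; have [j jk ->] := hs u us.
  apply/eqP; apply: contrapT => /negP; rewrite -mcoeff_msupp mpolyXn.
  rewrite (perm_mem (msuppMX _ _)) => /mapP[m' _ em].
  apply: hm; exists j => //; rewrite em mnmDE mulmnE mnm1E eqxx mul1n.
  exact: leq_addr.
by move/eqP; rewrite oner_eq0.
Qed.

Definition pair_monomial (n : nat) (l : 'I_n -> nat) (a b : 'I_n) : 'X_{1..n} :=
  (U_(a) *+ l a + U_(b) *+ l b)%MM.

Lemma pair_monomialE (n : nat) (l : 'I_n -> nat) (a b c : 'I_n) :
  a != b ->
  pair_monomial l a b c = if (c == a) || (c == b) then l c else 0%N.
Proof.
move=> ab; rewrite mnmDE !mulmnE !mnm1E ![_ == c]eq_sym.
case: eqP => [->|_] /=; first by rewrite (negPf ab) mul1n mul0n addn0.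
by case: eqP => [->|]; rewrite ?mul1n ?mul0n.
Qed.

(** A monomial of [Omega] is divisible by two of the powers [x_j ^ l_j]: by
    some first one, and then by another, taking for [k] the index of the
    first. *)
Lemma minimal_monomial_Omega (K : fieldType) (n : nat) (l : 'I_n -> nat)
    (m : 'X_{1..n}) :
  (0 < n)%N -> (forall j, 0 < l j)%N ->
  minimal_monomial (@Omega K n l) m <->
  exists a b : 'I_n, (a < b)%N /\ m = pair_monomial l a b.
Proof.
move=> n0 l0.
have two (m' : 'X_{1..n}) : @Omega K n l 'X_[m'] ->
    exists a b : 'I_n, [/\ (a < b)%N, (l a <= m' a)%N & (l b <= m' b)%N].
  move/Omega_monomial => h; have [j _ lj] := h (Ordinal n0).
  have [i ij li] := h j; have [lt|gt|/val_inj e] := ltngtP i j.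
  - by exists i, j.
  - by exists j, i.
  - by rewrite e eqxx in ij.
have neq (a b : 'I_n) : (a < b)%N -> a != b.
  by move=> ab; apply: contraTneq ab => ->; rewrite ltnn.
have pairO (a b : 'I_n) : (a < b)%N -> @Omega K n l 'X_[pair_monomial l a b].
  move=> ab; apply/Omega_monomial => k; have [ak|ak] := eqVneq a k.
    exists b; first by rewrite -ak eq_sym neq.
    by rewrite pair_monomialE ?neq // eqxx orbT.
  by exists a => //; rewrite pair_monomialE ?neq // eqxx.
have pair_le (a b : 'I_n) (m' : 'X_{1..n}) : (a < b)%N -> (l a <= m' a)%N ->
    (l b <= m' b)%N -> (pair_monomial l a b <= m')%MM.
  move=> ab la lb; apply/mnm_lepP => i; rewrite pair_monomialE ?neq //.
  by case: eqP => [->|_] //=; case: eqP => [->|].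
split=> [[/two[a [b [ab la lb]]] mmin]|[a [b [ab ->]]]].
  by exists a, b; split=> //; apply/esym/mmin; [apply: pairO | apply: pair_le].
split=> [|m' /two[a' [b' [ab' la' lb']]] m'le]; first exact: pairO.
have mem i : (l i <= m' i)%N -> (i == a) || (i == b).
  move=> li; have := leq_trans li (mnm_lepP m'le i).
  rewrite pair_monomialE ?neq //; case: ifP => // _.
  by rewrite leqNgt l0.
have [ea eb] : a' = a /\ b' = b.
  case/orP: (mem _ la') => /eqP ea; case/orP: (mem _ lb') => /eqP eb //.
  - by move: ab'; rewrite ea eb ltnn.
  - by move: ab'; rewrite ea eb => /ltnW; rewrite leqNgt ab.
  - by move: ab'; rewrite ea eb ltnn.
rewrite ea eb in la' lb' *.
apply/mnmP => i; apply/eqP; rewrite eqn_leq (mnm_lepP m'le) /=.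
exact: (mnm_lepP (pair_le _ _ _ ab la' lb')).
Qed.

Lemma lift_pair_monomial (K : fieldType) (n r : nat) (l : 'I_n -> nat)
    (L : 'M[linear_form K n]_(n, r)) (a b : 'I_n) :
  a != b -> lift_monomial L (pair_monomial l a b)
  = pair_prod (grid_form l L) (a, b).
Proof.
move=> ab; rewrite /lift_monomial /pair_prod (bigD1 a) //= (bigD1 b) //=; last first.
  by rewrite eq_sym.
rewrite [X in _ * (_ * X)]big1 ?mulr1 => [|c /andP[ca cb]].
  by rewrite /grid_form !pair_monomialE // !eqxx orbT.
by rewrite pair_monomialE // (negPf ca) (negPf cb) /= big_pred0.
Qed.

Lemma pseudo_lifting_Omega (K : fieldType) (n r : nat) (l : 'I_n -> nat)
    (L : 'M[linear_form K n]_(n, r)) p :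
  (0 < n)%N -> (forall j, 0 < l j)%N ->
  pseudo_lifting L (@Omega K n l) p <->
  in_span (pair_prod (grid_form l L)) [set u : 'I_n * 'I_n | (u.1 < u.2)%N] p.
Proof.
move=> n0 l0.
have neq (a b : 'I_n) : (a < b)%N -> a != b.
  by move=> ab; apply: contraTneq ab => ->; rewrite ltnn.
apply: ideal_gen_in_span => [q [m /(minimal_monomial_Omega _ _ n0 l0)]|[a b]].
  case=> a [b [ab ->]] ->; rewrite lift_pair_monomial ?neq //.
  by apply: in_span_gen; rewrite inE.
rewrite inE /= => ab; exists (pair_monomial l a b).
  by apply/minimal_monomial_Omega => //; exists a, b.
by rewrite lift_pair_monomial ?neq.
Qed.

Lemma mcoeff_affine (K : fieldType) (n : nat) (c : K) (j h : 'I_n) :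
  (('X_(lift ord0 j) - c *: 'X_ord0 : {mpoly K[n.+1]}))@_U_(lift ord0 h)
  = (j == h)%:R.
Proof.
rewrite mcoeffB mcoeffZ !mcoeffXU (inj_eq lift_inj).
by rewrite (negPf (neq_lift _ _)) mulr0 subr0.
Qed.

(** The case [k = Some j] replaces one of the forms by [x_0]: the regularity of
    [x_0] modulo the other forms is what separates the parallel hyperplanes
    of one row. *)
Lemma affine_free (K : fieldType) (n : nat) (k : option 'I_n) (b : 'I_n -> K)
    (v : 'I_n -> linear_form K n) :
  (forall j, mpoly_of_dhomog (v j) = if k == Some j then 'X_ord0
     else 'X_(lift ord0 j) - b j *: 'X_ord0) ->
  forall c : 'I_n -> K, \sum_j c j *: v j = 0 -> forall j, c j = 0.
Proof.
move=> ev c hc.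
have {}hc : \sum_j c j *: mpoly_of_dhomog (v j) = 0.
  transitivity (mpoly_of_dhomog (\sum_j c j *: v j)); last by rewrite hc.
  by rewrite raddf_sum.
have off j : k != Some j -> c j = 0.
  move=> kj; have := congr1 (mcoeff U_(lift ord0 j)) hc.
  rewrite mcoeff0 raddf_sum (bigD1 j) //= mcoeffZ ev (negPf kj).
  rewrite mcoeff_affine eqxx mulr1 big1 ?addr0 // => h hj.
  rewrite mcoeffZ ev; case: eqP => _; last by rewrite mcoeff_affine (negPf hj) mulr0.
  by rewrite mcoeffXU (negPf (neq_lift _ _)) mulr0.
move=> j; have [kj|] := eqVneq k (Some j); last exact: off.
have := congr1 (mcoeff U_(ord0)) hc; rewrite mcoeff0 raddf_sum (bigD1 j) //=.
rewrite mcoeffZ ev kj eqxx mcoeffXU eqxx mulr1 big1 ?addr0 // => h hj.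
by rewrite off ?scale0r ?mcoeff0 // kj; apply: contraNneq hj => -[->].
Qed.

Lemma line_point_coord (K : fieldType) (n : nat) (b : 'I_n -> K) (k : 'I_n)
    (s t : K) (h : 'I_n.+1) :
  (s *: row_mx 1%:M (\row_j b j) + t *: point_at_infinity K k) 0 h
  = if unlift ord0 h is Some j then s * b j + t * (j == k)%:R else s.
Proof.
rewrite /point_at_infinity !scale_row_mx add_row_mx.
case: unliftP => [j ->|->].
  have -> : lift ord0 j = rshift 1 j by apply/val_inj.
  by rewrite row_mxEr !mxE eqxx.
have -> : ord0 = lshift n (ord0 : 'I_1) by apply/val_inj.
by rewrite row_mxEl !mxE mulr0 addr0 mulr1.
Qed.

(** On the line of the points [(s, s b_j, t)], with [t] in position [k], the
    value of [p] is that of the polynomial obtained by substituting [b_j x_0]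
    for each [x_j], [j != k].  The latter vanishes wherever [x_0] does not,
    hence is zero over an infinite field, and [p] is in the ideal of the line. *)
Lemma vanishing_on_line (K : fieldType) (n : nat) (b : 'I_n -> K) (k : 'I_n)
    (p : {mpoly K[n.+1]}) :
  infinite_field K ->
  (forall v : 'rV[K]_(1 + n),
     proj_line (row_mx 1%:M (\row_j b j)) (point_at_infinity K k) v ->
     p.@[v 0] = 0) ->
  in_span (fun j => 'X_(lift ord0 j) - b j *: 'X_ord0) [set~ k] p.
Proof.
move=> infK hp; set g := fun j => _.
pose q (h : 'I_n.+1) : {mpoly K[n.+1]} :=
  if unlift ord0 h is Some j then
    if j == k then 'X_h else b j *: 'X_ord0
  else 'X_ord0.
pose lq := [tuple q h | h < n.+1].
have hlq : in_span g [set~ k] (p \mPo lq - p).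
  apply: comp_mpoly_in_span => h; rewrite tnth_mktuple /q.
  case: unliftP => [j ->|->]; last by rewrite subrr; apply: in_span0.
  case: eqP => [_|/eqP jk]; first by rewrite subrr; apply: in_span0.
  rewrite -opprB; apply/in_spanN/(in_span_gen g).
  by rewrite !inE.
suff p0 : p \mPo lq = 0.
  by move: hlq; rewrite p0 sub0r => /in_spanN; rewrite opprK.
have /eqP : 'X_ord0 * (p \mPo lq) = 0.
  apply: mpoly_vanishing => // v; rewrite mevalM mevalXU comp_mpoly_meval.
  have [->|v0] := eqVneq (v ord0) 0; first by rewrite mul0r.
  pose t := v (lift ord0 k) - v ord0 * b k.
  pose w : 'rV[K]_(1 + n) := v ord0 *: row_mx 1%:M (\row_j b j)
    + t *: point_at_infinity K k.
  have -> : p.@[fun h => (tnth lq h).@[v]] = p.@[w 0].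
    apply: meval_eq => h; rewrite tnth_mktuple line_point_coord /q.
    case: unliftP => [j ->|_]; last by rewrite mevalXU.
    case: eqP => [->|_]; first by rewrite mevalXU mulr1 /t addrC subrK.
    by rewrite mulr0 addr0 mevalZ mevalXU mulrC.
  rewrite hp ?mulr0 //; exists (v ord0), t; split=> //.
  by apply: contraNneq v0 => -[->].
rewrite mulf_eq0 => /orP[|/eqP //].
move=> /eqP/(congr1 (mcoeff U_(ord0))); rewrite mcoeffXU eqxx mcoeff0 => /eqP.
by rewrite oner_eq0.
Qed.

Lemma grid_form_vanishing (K : fieldType) (n r : nat) (l : 'I_n -> nat)
    (L : 'M[linear_form K n]_(n, r)) (a : 'M[K]_(n, r)) (v : 'rV[K]_(1 + n))
    (u : 'I_n * 'I_n) :
  (forall j i, mpoly_of_dhomog (L j i) = 'X_(lift ord0 j) - a j i *: 'X_ord0) ->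
  u.1 != u.2 -> complete_grid l a v ->
  (pair_prod (grid_form l L) u).@[v 0] = 0.
Proof.
move=> eL u12 [p [k [[i [il ->]] [s [t [_ ->]]]]]].
have vanish j : j != k -> (grid_form l L j).@[(s *: row_mx 1%:M
    (\row_j a j (i j)) + t *: point_at_infinity K k) 0] = 0.
  move=> jk; rewrite /grid_form rmorph_prod (bigD1 (i j)) //=.
  rewrite eL mevalB mevalZ !mevalXU.
  rewrite !line_point_coord liftK unlift_none (negPf jk) mulr0 addr0.
  by rewrite (mulrC s) subrr mul0r.
rewrite /pair_prod mevalM; have [u1k|u1k] := eqVneq u.1 k.
  by rewrite (vanish u.2) ?mulr0 // -u1k eq_sym.
by rewrite vanish ?mul0r.
Qed.

(** A polynomial that vanishes on the grid is in the ideal of each of its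
    lines.  For a fixed direction [k] these ideals intersect in
    [(f_j : j != k)] by [in_span_prods] with [z = x_0], since two forms of one
    row differ by a multiple of [x_0]; over all the directions, the
    intersection is that of [in_span_pairs]. *)
Lemma complete_grid_regular_and_ideal (K : fieldType) (n r : nat) (l : 'I_n -> nat)
    (L : 'M[linear_form K n]_(n, r)) (a : 'M[K]_(n, r)) :
  infinite_field K -> (0 < n)%N -> (forall j, 0 < l j)%N -> (forall j, l j <= r)%N ->
  (forall j, injective (a j)) ->
  (forall j i, mpoly_of_dhomog (L j i) = 'X_(lift ord0 j) - a j i *: 'X_ord0) ->
  regular_family (grid_form l L) /\
  forall p, proj_vanishing_ideal (complete_grid l a) p <->
  in_span (pair_prod (grid_form l L)) [set u : 'I_n * 'I_n | (u.1 < u.2)%N] p.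
Proof.
move=> infK n0 l0 lr ainj eL; rewrite grid_form_prods.
have s0 j : row_entries l L j != [::] by apply: row_entries_neq0.
have pick (c : 'I_n -> {mpoly K[n.+1]}) j : c j \in row_entries l L j ->
    {i : 'I_r | (i < l j)%N & c j = mpoly_of_dhomog (L j i)}.
  by move=> hc; apply: cid2; apply/row_entriesP.
have regk (k : option 'I_n) (c : 'I_n -> {mpoly K[n.+1]}) :
    (forall j, if k == Some j then c j = 'X_ord0 else c j \in row_entries l L j) ->
    regular_family c.
  move=> hc.
  have hv j : {v : linear_form K n * K | c j = mpoly_of_dhomog v.1 /\
      mpoly_of_dhomog v.1 = if k == Some j then 'X_ord0
        else 'X_(lift ord0 j) - v.2 *: 'X_ord0}.
    have := hc j; case: (k == Some j) => [->|/pick[i _ ->]].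
      by exists (DHomog (dhomogXU K ord0), 0).
    by exists (L j i, a j i); rewrite eL.
  have -> : c = fun j => mpoly_of_dhomog (sval (hv j)).1.
    by apply/funext => j; case: (svalP (hv j)).
  apply: (@regular_family_linear _ _ _ (fun j => (sval (hv j)).1)).
  apply: (@affine_free _ _ k (fun j => (sval (hv j)).2)) => j.
  by case: (svalP (hv j)).
have reg : regular_family (prods (row_entries l L)).
  by apply: regular_family_prods => // c hc; apply: (regk None).
split=> // p; apply: (iff_trans (B := ideal_gen (fun q => (exists d, q \is d.-homog)
  /\ forall v, complete_grid l a v -> q.@[v 0] = 0) p)) => //.
apply: ideal_gen_in_span => [q [_ hq]|u]; last first.
  rewrite inE -grid_form_prods => u12; split.
    by exists (l u.1 + l u.2)%N; apply: dhomogM; apply: grid_form_homog.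
  move=> v; apply: grid_form_vanishing eL _ => //.
  by apply: contraTneq u12 => ->; rewrite ltnn.
apply: in_span_pairs_lt; apply: (in_span_pairs (Ordinal n0)) => // k.
apply: (@in_span_prods _ _ _ _ 'X_ord0) => // [j|c ck hc|j x y xs ys xy|c hc].
- rewrite map_inj_uniq ?(filter_uniq _ (enum_uniq _)) // => i i'.
  rewrite !eL => /addrI/oppr_inj/(congr1 (mcoeff U_(ord0))).
  by rewrite !mcoeffZ mcoeffXU eqxx !mulr1 => /ainj.
- apply: (regk (Some k)) => j; case: eqP => [[<-] //|/eqP kj].
  by apply: hc; apply: contraNneq kj => ->.
- case/row_entriesP: xs xy => i _ ->; case/row_entriesP: ys => i' _ ->.
  rewrite !eL => xy; exists ((a j i - a j i')^-1)%:MP.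
  have d0 : a j i - a j i' != 0.
    by apply: contraNneq xy => /eqP; rewrite subr_eq0 => /eqP ->.
  rewrite opprB [X in _ * X]addrC addrA subrK -scalerBl mul_mpolyC scalerA mulVf //.
  by rewrite scale1r.
- pose i j := sval (cid2 (elimT (row_entriesP _ _ _ _) (hc j))).
  have iP j : (i j < l j)%N /\ c j = mpoly_of_dhomog (L j (i j)).
    by rewrite /i; case: cid2.
  have -> : c = fun j => 'X_(lift ord0 j) - a j (i j) *: 'X_ord0.
    by apply/funext => j; rewrite (iP j).2 eL.
  apply: vanishing_on_line => // v hv; apply: hq.
  exists (row_mx 1%:M (\row_j a j (i j))), k; split=> //.
  by exists i; split=> // j; case: (iP j).
Qed.

Theorem corollary6p4 (K : fieldType) (n : nat) (l : 'I_n -> nat) (r : nat)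
    (L : 'M[linear_form K n]_(n, r)) (I : {mpoly K[n.+1]} -> Prop) :
  infinite_field K -> (2 <= n)%N -> (forall j, (1 <= l j)%N) ->
  complete_grid_ideal l L I \/ complete_pseudo_grid_ideal l L I ->
  (exists C : complex K n.+1, iterated_mapping_cone l (grid_form l L) C) /\
  (forall C : complex K n.+1, iterated_mapping_cone l (grid_form l L) C ->
     [/\ minimal_graded_free_resolution C I,
         forall h, (h <= n - 2)%N ->
           perm_eq [seq cx_deg s | s : 'I_(cx_rank C h)] (expected_degrees l h)
       & forall h, (n - 2 < h)%N -> cx_rank C h = 0%N]).
Proof.
move=> infK n2 l1 hI; have n0 : (0 < n)%N := ltnW n2.
have [lr reg eI] : [/\ forall j, (l j <= r)%N, regular_family (grid_form l L)
    & forall p, I p <-> in_span (pair_prod (grid_form l L))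
        [set u : 'I_n * 'I_n | (u.1 < u.2)%N] p].
  case: hI => [[a [er ainj eL eI]]|[lmax hL eI]].
    have lr j : (l j <= r)%N by rewrite er; apply: leq_bigmax.
    have [reg eg] := complete_grid_regular_and_ideal infK n0 l1 lr ainj eL.
    by split=> // p; rewrite eI.
  have lr j : (l j <= r)%N by apply: leq_trans lmax; apply: leq_bigmax.
  split=> // [|p]; first exact: pseudo_regular.
  by rewrite eI; apply: pseudo_lifting_Omega.
have hf j : grid_form l L j \is (l j).-homog by apply: grid_form_homog.
split=> [|C run]; first exact: cone_run_exists.
have [[res min] degs ranks] := iterated_mapping_cone_resolution hf l1 reg run.
split=> //; split=> //.
by apply: graded_free_resolution_iff res => p; rewrite eI.
Qed.
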